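(* Let $k\geq 2$ be an integer and let $c_{k}=\sqrt{k(k-1)(k+2\sqrt{2k}+2)}$. Let $n_{1}(k)$ be the smallest positive integer such that $\frac{n+2k-2}{4}-2c_{k}\sqrt{n}-k^{2}-2k-1\geq 0$ for every integer $n\geq n_{1}(k)$. Let $G$ be a connected graph of order $n\geq n_{1}(k)$ with $\sigma_{2}(G)\geq \frac{n+2k-2}{2}$. Then $G$ has a $[2,k]$-ST if and only if $G$ has no $k$-blocking set.
   Context: All graphs are finite and simple. For a graph $G$ and $u\in V(G)$, $d_G(u)$ is the degree of $u$. If $G$ is not complete, $\sigma_{2}(G)=\min\{d_{G}(u)+d_{G}(v): u,v\in V(G),\ u\neq v,\ uv\notin E(G)\}$; if $G$ is complete, $\sigma_2(G)=\infty$. A $[2,k]$-ST of $G$ is a spanning tree $T$ of $G$ having no vertex whose degree in $T$ lies in $\{2,3,\dots,k\}$. For a connected graph $G$, a $k$-blocking set is a cutset $U\subseteq V(G)$ (a vertex set whose removal disconnects $G$) such that every vertex $u\in U$ satisfies $2\leq d_G(u)\leq k$. *)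

(* Defs.v *)
From HB Require Import structures.
From mathcomp Require Import all_boot all_order all_algebra.
From mathcomp Require Import boolp constructive_ereal reals.
From mathcomp Require Import lra.

Set Implicit Arguments.
Unset Strict Implicit.
Unset Printing Implicit Defensive.

Import Order.TTheory GRing.Theory Num.Theory.
Local Open Scope ring_scope.

Section Graphs.
Variable V : finType.
Implicit Types (E T : rel V) (U : {set V}) (k : nat).

Definition simple_graph E : Prop := symmetric E /\ irreflexive E.

Definition degree E (u : V) : nat := #|[set v | E u v]|.

Definition graph_connected E : Prop :=
  (0 < #|V|)%N /\ forall x y : V, connect E x y.

(* A cycle has at least 3 vertices: [ucycle] also accepts [::] and [:: x; y]
   for every edge xy. *)
Definition acyclic E : Prop :=
  forall c : seq V, (2 < size c)%N -> ~ ucycle E c.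

Definition spanning_tree E T : Prop :=
  [/\ simple_graph T, subrel T E, graph_connected T & acyclic T].

Definition has_2k_ST k E : Prop :=
  exists2 T : rel V, spanning_tree E T
    & forall v : V, ~ (2 <= degree T v <= k)%N.

Definition delete_vertices E U : rel V :=
  [rel x y | [&& x \notin U, y \notin U & E x y]].

Definition cutset E U : Prop :=
  exists x y : V,
    [/\ x \notin U, y \notin U & ~ connect (delete_vertices E U) x y].

Definition blocking_set k E U : Prop :=
  cutset E U /\ forall u, u \in U -> (2 <= degree E u <= k)%N.

(* The empty minimum, i.e. the case of a complete graph, is +oo. *)
Definition sigma2 (R : realType) E : \bar R :=
  \big[Order.min/+oo%E]_(p : V * V | (p.1 != p.2) && ~~ E p.1 p.2)
    ((degree E p.1 + degree E p.2)%:R)%:E.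

End Graphs.

Section Threshold.
Variable R : realType.

Definition c_ (k : nat) : R :=
  Num.sqrt (k%:R * (k%:R - 1) * (k%:R + 2 * Num.sqrt (2 * k%:R) + 2)).

Definition eventually_nonneg (k m : nat) : Prop :=
  forall n : nat, (m <= n)%N ->
    0 <= (n%:R + 2 * k%:R - 2) / 4 - 2 * c_ k * Num.sqrt n%:R
         - k%:R ^+ 2 - 2 * k%:R - 1 :> R.

Definition is_n1 (k m : nat) : Prop :=
  [/\ (0 < m)%N, eventually_nonneg k m
    & forall m' : nat, (0 < m')%N -> eventually_nonneg k m' -> (m <= m')%N].

Lemma n1_exists (k : nat) : (2 <= k)%N -> exists m, is_n1 k m.
Proof.
move=> k2.
have ex : exists m, (0 < m)%N && `[< eventually_nonneg k m >].
  have c0 : 0 <= c_ k by exact: sqrtr_ge0.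
  have K2 : 2 <= k%:R :> R by rewrite ler_nat.
  pose A := 8 * c_ k + 4 * (k%:R + 1) ^+ 2 + 1.
  have A0 : 1 <= A.
    have := sqr_ge0 (k%:R + 1 : R); rewrite /A; move: ((k%:R + 1) ^+ 2) => q q0.
    by lra.
  exists (Num.bound (A ^+ 2)).+1; rewrite ltn0Sn /=; apply/asboolP => n ln.
  have hn : A ^+ 2 <= n%:R.
    have : 0 <= A ^+ 2 by apply: sqr_ge0.
    move=> /archi_boundP /ltW /le_trans; apply.
    by rewrite ler_nat ltnW.
  set s := Num.sqrt n%:R.
  have sn : s ^+ 2 = n%:R by rewrite sqr_sqrtr.
  have sA : A <= s by rewrite -(ger0_norm (le_trans ler01 A0)) -sqrtr_sqr ler_sqrt.
  have s1 : 1 <= s by exact: le_trans sA.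
  have h1 : 0 <= s * (s - A) by rewrite mulr_ge0 ?subr_ge0 // (le_trans ler01).
  have h2 : 0 <= (s - 1) * (k%:R + 1) ^+ 2.
    by apply: mulr_ge0; [rewrite subr_ge0 | exact: sqr_ge0].
  rewrite -sn; move: h1 h2; rewrite /A => h1 h2.
  by nra.
exists (ex_minn ex); case: ex_minnP => m /andP[m0 /asboolP Pm] mn.
by split=> // m' m'0 Pm'; apply: mn; rewrite m'0; apply/asboolP.
Qed.

End Threshold.

(* Main.v *)
Require Import Defs.
From mathcomp Require Import all_boot all_order all_algebra.
From mathcomp Require Import constructive_ereal reals.
From mathcomp Require Import boolp zify lra.
Import Order.TTheory GRing.Theory Num.Theory.

Set Implicit Arguments.
Unset Strict Implicit.
Unset Printing Implicit Defensive.

(** Let n be the order of the graph, B the set of vertices of degree at most k and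
    Q the set of vertices of degree less than n/10; by the degree sum condition Q
    is a clique.  Vertices of B must be leaves of a [2,k]-ST, so a blocking set is
    an obstruction.  Without one, G - W is connected for every subset W of B.

    The tree is built around a connected set I of inner vertices dominating G: if
    the vertices of I have k private neighbours each outside I, a spanning tree of
    G[I] together with pendant edges is a [2,k]-ST.  When I has at most n/(10(k+1))
    vertices the private neighbours are found greedily, except for the members of
    Q.  A small I exists because, fixing a centre c, every non-neighbour of c sees
    a constant fraction of the graph: a greedy choice of O(log n) vertices
    dominates them, and vertices with so many neighbours cannot have pairwise
    disjoint neighbourhoods, so few connectors are needed.

    If Q = B, all of I avoids Q.  Otherwise G - Q has at most two components, and
    one or two vertices of Q - B connect them.  These serve as roots: each of them
    becomes the parent of the vertices of I that it alone is adjacent to.  In the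
    case of two, the degree sum condition applied to vertices without neighbours in
    Q shows that the roots have enough neighbours to serve both: this is where the
    term 2k - 2 is tight. *)

(** * The threshold *)

(* What is used of the threshold n1(k); [sqrt (2k)] is bounded below by 2. *)
Definition large_order (k n : nat) : Prop :=
  64 * (k * k.-1 * (k + 6)) + 4 * k.+1 ^ 2 + 2 <= n + 2 * k.

Lemma large_order_n1 (R : realType) (k n1 n : nat) :
  2 <= k -> is_n1 R k n1 -> n1 <= n -> large_order k n.
Proof.
move=> k2 [_ + _] n1n => /(_ n n1n).
have K2 : (2 <= k%:R :> R)%R by rewrite ler_nat.
rewrite /c_; set t := Num.sqrt (2 * _)%R; set c := Num.sqrt (_ * _)%R;
  set s := Num.sqrt _ => threshold.
have s0 : (0 <= s)%R by exact: sqrtr_ge0.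
have c0 : (0 <= c)%R by exact: sqrtr_ge0.
have t0 : (0 <= t)%R by exact: sqrtr_ge0.
have sE : (s ^+ 2 = n%:R)%R by rewrite sqr_sqrtr.
have tE : (t ^+ 2 = 2 * k%:R)%R by rewrite sqr_sqrtr //; lra.
have t_ge2 : (2 <= t)%R by nra.
have kk0 : (0 <= k%:R * (k%:R - 1) :> R)%R by nra.
have cE : (c ^+ 2 = k%:R * (k%:R - 1) * (k%:R + 2 * t + 2))%R.
  by rewrite sqr_sqrtr // mulr_ge0 //; lra.
have c_sq_ge : (k%:R * (k%:R - 1) * (k%:R + 6) <= c ^+ 2)%R.
  by rewrite cE ler_wpM2l //; lra.
rewrite -sE in threshold.
have s_ge_8c : (8 * c <= s)%R.
  rewrite leNgt; apply/negP => lt.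
  have : (s * (s - 8 * c) <= 0)%R by rewrite mulr_ge0_le0 // subr_le0 ltW.
  by nra.
have cs_ge : (64 * c ^+ 2 <= 8 * c * s)%R.
  by rewrite expr2 mulrA [leRHS]mulrAC ler_wpM2r //; nra.
have k1 : (k.-1%:R = k%:R - 1 :> R)%R by rewrite -[in RHS](ltn_predK k2) -natr1; lra.
rewrite /large_order -(ler_nat R) !(natrD, natrM, natrX) k1 -(natr1 k) -sE.
move: (k%:R)%R (k%:R * (k%:R - 1) * (k%:R + 6))%R threshold cs_ge c_sq_ge => K X.
by nra.
Qed.

Lemma exp_overtakes (a b n : nat) : 0 < a -> 5 * a <= 4 * b ->
  exists m, n * a ^ m < b ^ m.
Proof.
move=> a0 ab; exists (4 * n); rewrite !expnM.
have le2 : 2 * a ^ 4 <= b ^ 4.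
  have : (5 * a) ^ 4 <= (4 * b) ^ 4 by rewrite leq_exp2r.
  by rewrite !expnMn; lia.
have [->|n0] := posnP n; first by [].
have le2n : (2 * a ^ 4) ^ n <= (b ^ 4) ^ n by rewrite leq_exp2r.
rewrite expnMn in le2n; apply: leq_trans le2n.
by rewrite ltn_pmul2r ?expn_gt0 ?a0 //; exact: ltn_expl.
Qed.

(* When [j] increases by 1 the bound on [m] increases by 2, so the right side
   gains the factor [(b / a) ^ 2 >= 25 / 16], more than the left side does. *)
Lemma quadratic_le_exp (a b d m0 : nat) : 17 <= m0 -> 5 * a <= 4 * b ->
  3 * d * (3 * m0 + 19) * a ^ m0 <= 2 * b ^ m0 ->
  forall j m, m0 + 2 * j <= m ->
    d * ((j + 3) * (3 * m + 2 * j + 19)) * a ^ m <= 2 * b ^ m.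
Proof.
move=> m0_ge ab base.
have ab2 : 25 * a ^ 2 <= 16 * b ^ 2.
  have : (5 * a) ^ 2 <= (4 * b) ^ 2 by rewrite leq_exp2r.
  by rewrite !expnMn.
have diagonal j : d * ((j + 3) * (3 * (m0 + 2 * j) + 2 * j + 19)) * a ^ (m0 + 2 * j)
    <= 2 * b ^ (m0 + 2 * j).
  elim: j => [|j IH]; first by rewrite muln0 !addn0 mulnA (mulnC d).
  have -> : m0 + 2 * j.+1 = (m0 + 2 * j) + 2 by lia.
  have : 16 * ((j.+1 + 3) * (3 * (m0 + 2 * j + 2) + 2 * j.+1 + 19)) <=
      25 * ((j + 3) * (3 * (m0 + 2 * j) + 2 * j + 19)) by nia.
  rewrite !(expnD _ _ 2); move: IH.
  move: (_ * (_ + 19)) (_ * (_ + 19)) => p q IH grow.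
  move: (a ^ (m0 + 2 * j)) (b ^ (m0 + 2 * j)) IH => x y IH.
  move: (a ^ 2) (b ^ 2) ab2 => a2 b2 ab2.
  have := leq_mul (leq_mul (leqnn d) grow) (leqnn (a2 * x)).
  have := leq_mul ab2 IH.
  by lia.
move=> j; elim=> [|m IH] jm; first by lia.
have [->|jm'] : m.+1 = m0 + 2 * j \/ m0 + 2 * j <= m by lia.
  exact: diagonal.
rewrite !expnS; move: (a ^ m) (b ^ m) (IH jm') => x y {}IH.
have grow : 4 * ((j + 3) * (3 * m.+1 + 2 * j + 19)) <=
  5 * ((j + 3) * (3 * m + 2 * j + 19)) by nia.
have := leq_mul (leq_mul (leqnn d) grow) (leqnn (a * x)).
have := leq_mul ab IH.
by lia.
Qed.

(* [2116 / 2 = 1058] is the least order that [large_order 2] allows. *)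
Lemma large_order_greedy_steps (a b d m0 k n : nat) : 0 < a -> 5 * a <= 4 * b ->
  17 <= m0 -> d <= 10 -> 3 * d * (3 * m0 + 16) <= 2116 ->
  3 * d * (3 * m0 + 19) * a ^ m0 <= 2 * b ^ m0 ->
  2 <= k -> large_order k n ->
  exists2 m, n * a ^ m < b ^ m & d * (k.+1 * (m + m./2 + k + 6)) <= n.
Proof.
move=> a0 ab m0_ge d_le m0_le base k2.
have [j ->] : exists j, k = j + 2 by exists (k - 2); lia.
rewrite /large_order (_ : (j + 2).-1 = j.+1) => [n_ge|]; last by lia.
case: (ex_minnP (@exp_overtakes a b n a0 ab)) => m nm m_min; exists m => //.
case: m => [|m] in nm m_min *; first by rewrite !expn0 in nm; nia.
rewrite leqNgt; apply/negP => lt_n.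
have bm : b ^ m <= n * a ^ m by rewrite leqNgt; apply/negP => /m_min; rewrite ltnn.
have lt_2n : 2 * n < d * ((j + 3) * (3 * m + 2 * j + 19)).
  have half : 2 * (m.+1 + (m.+1)./2 + (j + 2) + 6) <= 3 * m + 2 * j + 19 by lia.
  by have := leq_mul (leqnn (d * (j + 3))) half; lia.
have [jm|jm] := leqP (m0 + 2 * j) m.
  have am0 : 0 < a ^ m by rewrite expn_gt0 a0.
  have := @quadratic_le_exp a b d m0 m0_ge ab base j m jm.
  by move: (d * _) lt_2n bm am0 => f; move: (a ^ m) (b ^ m); clear; nia.
have le_f : d * (3 * m + 2 * j + 19) <= 705 + 80 * j.
  have le_m : 3 * m + 2 * j + 19 <= 3 * m0 + 16 + 8 * j by lia.
  by have := leq_mul (leqnn d) le_m; have := leq_mul d_le (leqnn (8 * j)); lia.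
have := leq_mul (leqnn (j + 3)) le_f.
by move: n_ge lt_2n; rewrite -mulnn; clear; nia.
Qed.

Lemma large_order_greedy_steps_2_3 (k n : nat) : 2 <= k -> large_order k n ->
  exists2 m, n * 2 ^ m < 3 ^ m & k.+1 * (m + m./2 + k + 6) <= n %/ 10.
Proof.
move=> k2 n_ge; have [||||||m nm le_n] :=
  @large_order_greedy_steps 2 3 10 18 k n _ _ _ _ _ _ k2 n_ge; try lia.
by exists m; rewrite // leq_divRL // mulnC.
Qed.

Lemma large_order_greedy_steps_19_25 (k n : nat) : 2 <= k -> large_order k n ->
  exists2 m, n * 19 ^ m < 25 ^ m & 7 * (k.+1 * (m + m./2 + k + 6)) <= n.
Proof.
move=> k2 n_ge.
by apply: (@large_order_greedy_steps 19 25 7 26 k n _ _ _ _ _ _ k2 n_ge); lia.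
Qed.

(** * Connectivity and domination *)

Lemma subset_of_card (T : finType) (A : {set T}) (m : nat) : m <= #|A| ->
  exists2 X : {set T}, X \subset A & #|X| = m.
Proof.
move=> /card_geqP[s [us sm sA]]; exists [set x in s].
  by apply/subsetP => x; rewrite inE; exact: sA.
by rewrite cardsE; move/card_uniqP: us => ->.
Qed.

Lemma disjoint_subsets_of_card (T : finType) (A B : {set T}) (a b : nat) :
  a <= #|A| -> b <= #|B| -> a + b <= #|A :|: B| ->
  exists X Y : {set T}, [/\ X \subset A, Y \subset B, [disjoint X & Y], #|X| = a
    & #|Y| = b].
Proof.
move=> aA bB abAB; have cAB := cardsUI A B; have cA := cardsID B A.
have [le_a|lt_a] := leqP a #|A :\: B|.
  have [X XA cX] := subset_of_card le_a; have [Y YB cY] := subset_of_card bB.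
  exists X, Y; split=> //; first exact: subset_trans XA (subsetDl _ _).
  apply: disjointWr YB _; apply: disjointWl XA _.
  by rewrite disjoints_subset setDE subsetIr.
have [|Z ZAB cZ] := @subset_of_card _ (A :&: B) (a - #|A :\: B|); first by lia.
have ZB : Z \subset B := subset_trans ZAB (subsetIr _ _).
have [|Y YB cY] := @subset_of_card _ (B :\: Z) b.
  by have := cardsID Z B; rewrite (setIidPr ZB); lia.
have disABZ : (A :\: B) :&: Z = set0.
  by apply/eqP; rewrite setI_eq0 disjoint_sym; apply: disjointWl ZB _;
    rewrite disjoint_sym disjoints_subset setDE subsetIr.
exists ((A :\: B) :|: Z), Y; split=> //.
- by rewrite subUset subsetDl (subset_trans ZAB (subsetIl _ _)).
- exact: subset_trans YB (subsetDl _ _).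
- rewrite disjoint_sym; apply: disjointWl YB _.
  rewrite disjoints_subset; apply/subsetP => z; rewrite !inE => /andP[/negPf-> ->].
  by [].
- by rewrite cardsU disABZ cards0; lia.
Qed.

Definition nbrs (V : finType) (E : rel V) (x : V) : {set V} := [set y | E x y].

Definition induced (V : finType) (E : rel V) (A : {set V}) : rel V :=
  fun x y => [&& x \in A, y \in A & E x y].
Arguments induced V E A x y /.

Definition connected_on (V : finType) (E : rel V) (A : {set V}) : Prop :=
  forall x y, x \in A -> y \in A -> connect (induced E A) x y.

Definition component (V : finType) (E : rel V) (A : {set V}) (x : V) : {set V} :=
  [set y | connect (induced E A) x y].

Definition dominating (V : finType) (E : rel V) (A A' : {set V}) : Prop :=
  forall v, v \in A' -> v \notin A -> exists2 u, u \in A & E u v.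

Definition attaches (V : finType) (E : rel V) (A A' : {set V}) (f : V -> V) : Prop :=
  forall v, v \in A' -> v \notin A -> f v \in A /\ E (f v) v.

Lemma dominating_attaches (V : finType) (E : rel V) (A A' : {set V}) :
  dominating E A A' -> exists f, attaches E A A' f.
Proof.
move=> dA; apply: (@fin_all_exists _ (fun=> V)
  (fun v u => v \in A' -> v \notin A -> u \in A /\ E u v)) => v.
have [/andP[vA' vA]|] := boolP ((v \in A') && (v \notin A)).
  by have [u uA uv] := dA v vA' vA; exists u.
by rewrite negb_and => nv; exists v => vA' vA; rewrite vA' vA in nv.
Qed.

Section Connectivity.
Variables (V : finType) (E : rel V).
Hypothesis sE : symmetric E.
Implicit Types (A K L : {set V}) (x y v : V).

Lemma in_nbrs x y : (y \in nbrs E x) = E x y.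
Proof. by rewrite inE. Qed.

Lemma card_nbrs x : #|nbrs E x| = degree E x.
Proof. by []. Qed.

Lemma degree_le_nbrsI A x : degree E x <= #|nbrs E x :&: A| + #|~: A|.
Proof.
by rewrite -card_nbrs -(cardsID A) leq_add2l subset_leq_card // setDE subsetIr.
Qed.

Lemma degree_lt_card A x : irreflexive E -> x \in A -> nbrs E x \subset A ->
  degree E x < #|A|.
Proof.
move=> iE xA NA; rewrite -card_nbrs (cardsD1 x A) xA add1n ltnS.
by rewrite subset_leq_card // subsetD1 NA in_nbrs iE.
Qed.

Lemma induced_sym A : symmetric (induced E A).
Proof. by move=> x y; rewrite /= sE andbCA. Qed.

Lemma connect_induced_sub A A' x y : A \subset A' ->
  connect (induced E A) x y -> connect (induced E A') x y.
Proof.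
move=> /subsetP sA; apply: connect_sub => u v /and3P[uA vA uv].
by apply: connect1; rewrite /= !sA.
Qed.

Lemma connected_on_exit A K x y : connected_on E A ->
  x \in A -> y \in A -> x \in K -> y \notin K ->
  exists u v, [/\ u \in A :&: K, v \in A :\: K & E u v].
Proof.
move=> cA xA yA xK yK; apply: contrapT => no.
have clK : closed (induced E A) K.
  apply: (intro_closed (sym_connect_sym (induced_sym A))) => u v /and3P[uA vA uv] uK.
  apply: contraPT (no) => vK; apply; exists u, v.
  by rewrite !inE uA uK vA vK.
by rewrite -(closed_connect clK (cA x y xA yA)) xK in yK.
Qed.

Lemma connected_on1 x : connected_on E [set x].
Proof. by move=> u v /set1P -> /set1P ->; exact: connect0. Qed.

Lemma connected_on_sub_component A x : x \in A -> A \subset component E A x ->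
  connected_on E A.
Proof.
move=> xA /subsetP sA u v uA vA; have := sA v vA; have := sA u uA.
rewrite !inE (sym_connect_sym (induced_sym A)) => ux; exact: connect_trans.
Qed.

Lemma connected_onU A A' x y : connected_on E A -> connected_on E A' ->
  x \in A -> y \in A' -> E x y -> connected_on E (A :|: A').
Proof.
move=> cA cA' xA yA' xy; apply: (@connected_on_sub_component _ x).
  by rewrite inE xA.
apply/subsetP => z /setUP[zA|zA']; rewrite inE.
  exact: connect_induced_sub (subsetUl _ _) (cA _ _ xA zA).
apply: connect_trans (connect_induced_sub (subsetUr A _) (cA' _ _ yA' zA')).
by apply: connect1; rewrite /= !inE xA yA' xy orbT.
Qed.

Lemma connected_on_dominated A A' : connected_on E A -> dominating E A A' ->
  connected_on E (A :|: A').
Proof.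
move=> cA dA u v uU.
have [A0|[a aA]] := set_0Vmem A.
  have u' : u \in A' by move: uU; rewrite A0 set0U.
  by have [|w] := dA u u'; rewrite A0 inE.
apply: (@connected_on_sub_component _ a) uU; first by rewrite inE aA.
have inA w : w \in A -> connect (induced E (A :|: A')) a w.
  by move=> wA; apply: connect_induced_sub (subsetUl _ _) (cA _ _ aA wA).
apply/subsetP => w wU; rewrite inE; have [/inA //|wA] := boolP (w \in A).
have [|z zA zw] := dA w _ wA; first by case/setUP: wU wA => // ->.
by apply: connect_trans (inA z zA) _; apply: connect1; rewrite /= wU inE zA.
Qed.

Lemma component_self A x : x \in component E A x.
Proof. by rewrite inE connect0. Qed.

Lemma component_sub A x : x \in A -> component E A x \subset A.
Proof.
move=> xA; apply/subsetP => y; rewrite inE => /connectP[p + ->].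
by elim: p x xA => //= z p IH x xA /andP[/and3P[_ zA _]]; exact: IH.
Qed.

Lemma component_step A x y z : x \in A -> y \in component E A x -> z \in A -> E y z ->
  z \in component E A x.
Proof.
move=> xA yC zA yz; have yA := subsetP (component_sub xA) y yC.
move: yC; rewrite !inE => xy; apply: connect_trans xy _.
by apply: connect1; rewrite /= yA zA.
Qed.

(* Leaving the component of [x] in [A :\: L] together with the vertices of [L]
   attached to it would require a second edge at a vertex of [L]. *)
Lemma connected_on_setD_leaves A L : connected_on E A ->
  (forall v, v \in L -> #|nbrs E v :&: A| <= 1) -> connected_on E (A :\: L).
Proof.
move=> cA leafL x y xAL yAL; pose C := component E (A :\: L) x.
have [yC|yC] := boolP (y \in C); first by rewrite inE in yC.
pose K := C :|: [set l in L | [exists w in C, E l w]].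
have [xA _] := setDP xAL; have [yA yL] := setDP yAL.
have xK : x \in K by rewrite inE component_self.
have yK : y \notin K by rewrite !inE negb_or (negPf yL) andbT; rewrite inE in yC.
have [u [v [/setIP[uA uK] /setDP[vA vK] uv]]] := connected_on_exit cA xA yA xK yK.
have vC : v \notin C by apply: contraNN vK => vC; rewrite inE vC.
case/negP: vC; case/setUP: uK => [uC|].
  have [vL|vL] := boolP (v \in L); last first.
    by apply: component_step xAL uC _ uv; rewrite inE vL.
  case/negP: vK; rewrite inE; apply/orP; right; rewrite inE vL.
  by apply/exists_inP; exists u; rewrite // sE.
rewrite inE => /andP[uL /exists_inP[w wC uw]].
have /card_le1_eqP /(_ w v) -> // := leafL u uL; rewrite inE in_nbrs ?uv //.
by rewrite uw; case/setDP: (subsetP (component_sub xAL) _ wC).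
Qed.

Lemma connected_on_component A x : x \in A -> connected_on E (component E A x).
Proof.
move=> xA; apply: (@connected_on_sub_component _ x); first exact: component_self.
have toC : forall p y, y \in component E A x -> path (induced E A) y p ->
    connect (induced E (component E A x)) y (last y p).
  elim=> [|z p IH] y yC /=; first by rewrite connect0.
  move=> /andP[/and3P[_ zA yz] zp]; have zC := component_step xA yC zA yz.
  by apply: connect_trans (IH z zC zp); apply: connect1; rewrite /= yC zC.
apply/subsetP => y; rewrite inE => /connectP[p xp ->]; rewrite inE.
exact: toC (component_self _ _) xp.
Qed.

Lemma component_disjoint A x y : y \notin component E A x ->
  [disjoint component E A x & component E A y].
Proof.
move=> yx; rewrite disjoint_subset; apply/subsetP => z xz.
rewrite unfold_in /=; apply: contraNN yx => yz.
rewrite !inE in xz yz *; apply: connect_trans xz _.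
by rewrite (sym_connect_sym (induced_sym A)).
Qed.

End Connectivity.

(** * Spanning trees from parent maps *)

Section ParentTree.
Variables (V : finType) (E : rel V) (r : V).
Hypothesis sE : symmetric E.
Hypothesis iE : irreflexive E.
Implicit Types (A I X : {set V}) (par f : V -> V) (u v x : V).

Definition parent_map A par : Prop := exists rank : V -> nat,
  forall v, v \in A -> v != r ->
    [/\ par v \in A, E (par v) v & rank (par v) < rank v].

Lemma parent_map1 par : parent_map [set r] par.
Proof. by exists (fun=> 0) => v /set1P ->; rewrite eqxx. Qed.

Lemma parent_map_attach A A' par f : parent_map A par -> attaches E A A' f ->
  parent_map (A :|: A') (fun v => if v \in A then par v else f v).
Proof.
move=> [rank parP] fP; exists (fun v => if v \in A then rank v else (rank (f v)).+1).
move=> v /setUP vU vr; case: (boolP (v \in A)) => [/parP/(_ vr)[pA pv lt]|vA].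
  by rewrite inE pA.
by case: vU vA => [->//|vA'] vA; have [fA fv] := fP v vA' vA; rewrite inE fA.
Qed.

Lemma parent_map_extend A A' par : connected_on E A' -> A \subset A' ->
  r \in A -> parent_map A par -> exists2 par', parent_map A' par' & {in A, par' =1 par}.
Proof.
move=> cA'; have [m] := ubnP #|A' :\: A|; elim: m A par => // m IH A par.
rewrite ltnS => cm AA' rA parP.
have [A'A|] := boolP (A' \subset A).
  by exists par => //; rewrite (_ : A' = A) //; apply/eqP; rewrite eqEsubset A'A.
case/subsetPn => y yA' yA.
have [u [v [/setIP[uA' uA] /setDP[vA' vA] uv]]] :=
  connected_on_exit sE cA' (subsetP AA' r rA) yA' rA yA.
have fP : attaches E A [set v] (fun=> u) by move=> w /set1P -> _.
have [|||par' parP' eq_par] := IH _ _ _ _ _ (parent_map_attach parP fP).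
- apply: leq_trans cm; apply: proper_card; rewrite properE setDS ?subsetUl //=.
  by apply/subsetPn; exists v; rewrite !inE ?vA // eqxx orbT.
- by rewrite subUset AA' sub1set.
- by rewrite inE rA.
by exists par' => // w wA; rewrite eq_par ?wA // inE wA.
Qed.

Definition private_nbrs X x : {set V} :=
  [set u | (u \notin X) && (nbrs E u :&: X == [set x])].

Lemma star_parent_map I X : connected_on E I -> X \subset I -> r \in X ->
  (forall x, x \in X -> x != r -> E r x) ->
  exists par, [/\ parent_map I par, {in X, forall x, par x = r}
    & forall x u, u \in private_nbrs X x :&: I -> par u = x].
Proof.
move=> cI XI rX star.
have starP : attaches E [set r] X (fun=> r).
  by move=> x xX; rewrite !inE eqxx => xr; split=> //; exact: star.
pose N := [set u in I | nbrs E u :&: X != set0].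
have [|f fP] := @dominating_attaches V E X N.
  move=> u; rewrite inE => /andP[_ /set0Pn[x]].
  by rewrite inE in_nbrs => /andP[ux xX] _; exists x; rewrite // sE.
have parX := parent_map_attach (parent_map1 (fun=> r)) starP.
have rU : [set r] :|: X = X by apply/setUidPr; rewrite sub1set.
rewrite rU in parX; have parN := parent_map_attach parX fP.
have [||par parI eq_par] := parent_map_extend cI _ _ parN.
- by rewrite subUset XI; apply/subsetP => u; rewrite inE => /andP[].
- by rewrite inE rX.
exists par; split=> // [x xX|x u /setIP[]].
  by rewrite eq_par ?inE ?xX // if_same.
rewrite inE => /andP[uX /eqP uN] uI.
have uN' : u \in N by rewrite inE uI uN -card_gt0 cards1.
have [fX fu] := fP u uN' uX.
rewrite eq_par ?(negPf uX); last by rewrite inE uN' orbT.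
by apply/set1P; rewrite -uN inE in_nbrs sE fu.
Qed.

Section Spanning.
Variable par : V -> V.
Hypothesis parP : parent_map setT par.

Definition parent_tree : rel V :=
  fun x y => (x != r) && (par x == y) || (y != r) && (par y == x).
Arguments parent_tree x y /.

Lemma parent_tree_sym : symmetric parent_tree.
Proof. by move=> x y; rewrite /= orbC. Qed.

Lemma parent_tree_sub : subrel parent_tree E.
Proof.
have [rank rankP] := parP.
by move=> x y /orP[] /andP[/(rankP _ (in_setT _))[_ par_edge _] /eqP <-] //; rewrite sE.
Qed.

Lemma parent_tree_connected x y : connect parent_tree x y.
Proof.
have [rank rankP] := parP.
have to_root v : connect parent_tree v r.
  have [m] := ubnP (rank v); elim: m v => // m IH v; rewrite ltnS => vm.
  have [->|vr] := eqVneq v r; first exact: connect0.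
  have [_ _ lt] := rankP v (in_setT v) vr.
  apply: connect_trans (IH (par v) (leq_trans lt vm)).
  by apply: connect1; rewrite /= vr eqxx.
by apply: connect_trans (to_root x) _; rewrite (sym_connect_sym parent_tree_sym).
Qed.

(* On a cycle, both neighbours of a vertex of maximal rank are its parent. *)
Lemma parent_tree_acyclic : acyclic parent_tree.
Proof.
have [rank rankP] := parP.
move=> c sc /andP[cc uc].
have [x0 x0c] : exists x, x \in c.
  by case: c sc {cc uc} => // x c _; exists x; rewrite mem_head.
case: (@arg_maxnP _ x0 (mem c) rank x0c) => x xc x_max.
have [i p cE] := rot_to xc.
have cr : cycle parent_tree (x :: p) by rewrite -cE rot_cycle.
have ur : uniq (x :: p) by rewrite -cE rot_uniq.
have sp : 1 < size p by rewrite -(size_rot i) cE in sc.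
have nbr_par y : y \in x :: p -> parent_tree x y -> y = par x.
  rewrite -cE mem_rot => /x_max; rewrite /= => yx.
  case/orP=> /andP[yr /eqP yE]; first by rewrite yE.
  by have [_ _] := rankP y (in_setT y) yr; rewrite yE ltnNge yx.
case/lastP: p => [|[|y p] z] // in cr ur sp nbr_par {cE} *.
move: cr => /= /andP[xy]; rewrite rcons_path last_rcons => /andP[_ zx].
have yE : y = par x by apply: nbr_par xy; rewrite !inE eqxx orbT.
have zE : z = par x.
  by apply: nbr_par; rewrite ?(parent_tree_sym x) // !inE mem_rcons mem_head !orbT.
by move: ur; rewrite /= yE zE mem_rcons mem_head andbF.
Qed.

Lemma parent_tree_spanning : spanning_tree E parent_tree.
Proof.
split; [split | exact: parent_tree_sub | split | exact: parent_tree_acyclic].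
- exact: parent_tree_sym.
- by move=> x; apply/negP => /parent_tree_sub; rewrite iE.
- by apply/card_gt0P; exists r.
- exact: parent_tree_connected.
Qed.

Definition children v : {set V} := [set u | (u != r) && (par u == v)].

Lemma parent_tree_degree v : degree parent_tree v = (v != r) + #|children v|.
Proof.
have [rank rankP] := parP.
have [->|vr] := eqVneq v r.
  by apply: eq_card => u; rewrite !inE /= eqxx.
rewrite /degree (cardD1 (par v)) !inE /= vr eqxx /=; congr (_ + _).
apply: eq_card => u; rewrite !inE /= (eq_sym _ u).
have [->|//] := eqVneq u (par v); symmetry; apply/negP => /andP[pr /eqP ppv].
have [_ _] := rankP _ (in_setT _) pr; have [_ _] := rankP v (in_setT v) vr.
by rewrite ppv; lia.
Qed.

End Spanning.
End ParentTree.

Section PrescribedInnerVertices.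
Variables (V : finType) (E : rel V).
Hypothesis sE : symmetric E.
Hypothesis iE : irreflexive E.
Implicit Types (F I J S X : {set V}) (a : V -> V) (k : nat).

Lemma reserve_leaves k I F J a0 : I \subset F -> J \subset I ->
  attaches E I setT a0 ->
  (forall i, i \in J -> k * #|J| <= #|nbrs E i :\: F|) ->
  exists a, [/\ attaches E I setT a, {in F, a =1 a0}
    & forall i, i \in J -> k <= #|[set v | (v \notin F) && (a v == i)]|].
Proof.
have [m] := ubnP #|J|; elim: m J F a0 => // m IH J F a0.
rewrite ltnS => Jm IF JI a0P free.
have [->|[i iJ]] := set_0Vmem J; first by exists a0; split=> // j; rewrite inE.
have cJ : #|J| = #|J :\ i|.+1 by rewrite [LHS](cardsD1 i) iJ.
have [|X XN cX] := @subset_of_card _ (nbrs E i :\: F) k.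
  by apply: leq_trans (free i iJ); rewrite cJ mulnS leq_addr.
have XP v : v \in X -> v \notin F /\ E i v.
  by move=> /(subsetP XN); rewrite !inE => /andP[].
pose a1 v := if v \in X then i else a0 v.
have [|||||a [aP a_eq ak]] := IH (J :\ i) (F :|: X) a1.
- by rewrite -ltnS -cJ.
- exact: subset_trans IF (subsetUl _ _).
- exact: subset_trans (subsetDl _ _) JI.
- move=> v vT vI; rewrite /a1; case: ifP => [/XP[_ iv]|_]; last exact: a0P.
  by split=> //; exact: (subsetP JI).
- move=> j /setD1P[_ jJ]; have := free j jJ; rewrite -setDDl.
  have := cardsID X (nbrs E j :\: F); rewrite cJ mulnS.
  by have := subset_leq_card (subsetIr (nbrs E j :\: F) X); lia.
exists a; split=> // [v vF|j jJ].
  by rewrite a_eq ?inE ?vF // /a1; case: ifP => // /XP[]; rewrite vF.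
have [->|ji] := eqVneq j i.
  rewrite -cX; apply: subset_leq_card; apply/subsetP => v vX.
  by rewrite !inE a_eq ?inE ?vX ?orbT // /a1 vX eqxx andbT; case: (XP v vX).
apply: leq_trans (ak j _) _; first by rewrite !inE ji.
apply: subset_leq_card; apply/subsetP => v; rewrite !inE negb_or -andbA.
by case/and3P=> -> _.
Qed.

Definition leaves I a i : {set V} := [set v | (v \notin I) && (a v == i)].

(* In the tree [X] spans a star with centre [r]. *)
Lemma framed_tree I X r a : connected_on E I -> X \subset I -> r \in X ->
  (forall x, x \in X -> x != r -> E r x) -> attaches E I setT a ->
  exists T, [/\ spanning_tree E T, forall v, v \notin I -> degree T v = 1,
    forall v, v \in I :\: X -> #|leaves I a v| < degree T v
    & forall x, x \in X -> #|leaves I a x| + #|private_nbrs E X x :&: I|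
        + (if x == r then #|X|.-1 else 1) <= degree T x].
Proof.
move=> cI XI rX star aP.
have [par0 [par0P par0_star par0_private]] := star_parent_map sE cI XI rX star.
have := parent_map_attach par0P aP; rewrite setUT.
set par := (fun v => _) => parP.
have outI v : v \notin I -> v != r by apply: contraNneq => ->; exact: (subsetP XI).
have degE := parent_tree_degree parP.
have leaves_sub v : leaves I a v \subset children r par v.
  apply/subsetP => u; rewrite !inE => /andP[uI au].
  by rewrite outI // /par (negPf uI).
exists (parent_tree r par); split=> [|v vI|v /setDP[vI vX]|x xX]; rewrite ?degE.
- exact: parent_tree_spanning parP.
- rewrite outI // (_ : children r par v = set0) ?cards0 //.
  apply/setP => u; rewrite !inE; apply/negP => /andP[ur /eqP uv].
  case/negP: vI; rewrite -uv /par; case: ifP => [uI|/negbT uI].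
    by have [rank /(_ u uI ur)[]] := par0P.
  by have [] := aP u (in_setT u) uI.
- rewrite (_ : v != r); last by apply: contraNneq vX => ->.
  by rewrite add1n ltnS subset_leq_card.
pose Y := if x == r then X :\ r else set0.
have xY : (x != r) + #|Y| = if x == r then #|X|.-1 else 1.
  by rewrite /Y; case: eqVneq => _; rewrite ?cards0 // (cardsD1 r X) rX.
rewrite -xY addnCA leq_add2l.
set L := leaves I a x; set N := private_nbrs E X x :&: I.
have dLN : L :&: N = set0.
  by apply/setP => u; rewrite !inE; apply/negP => /and3P[/andP[/negPf-> _] _].
have dLNY : (L :|: N) :&: Y = set0.
  apply/setP => u; rewrite !inE; apply/negP => /andP[uLN uY].
  have uX : u \in X by move: uY; rewrite /Y; case: ifP; rewrite !inE // => _ /andP[].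
  by move: uLN; rewrite uX (subsetP XI u uX).
rewrite -[#|L| + _]subn0 -(cards0 V) -dLN -cardsU -[_ + #|Y|]subn0 -(cards0 V) -dLNY.
rewrite -cardsU subset_leq_card // !subUset leaves_sub /=.
apply/andP; split; apply/subsetP => u.
  move=> uN; have pu := par0_private x u uN; case/setIP: uN; rewrite !inE.
  case/andP=> uX _ uI; rewrite /par uI pu eqxx andbT.
  by apply: contraNneq uX => ->.
rewrite /Y; case: eqVneq => [->|_]; last by rewrite inE.
by case/setD1P=> ur uX; rewrite inE ur /par (subsetP XI) // par0_star /=.
Qed.

Lemma framed_2k_ST k I X S r a : connected_on E I -> X \subset I -> r \in X ->
  (forall x, x \in X -> x != r -> E r x) -> attaches E I setT a ->
  (forall i, i \in I :\: X -> k * #|I :\: X| + #|I :|: S| <= degree E i) ->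
  (forall x, x \in X -> k < #|leaves I a x :&: S| + #|private_nbrs E X x :&: I|
     + (if x == r then #|X|.-1 else 1)) ->
  has_2k_ST k E.
Proof.
move=> cI XI rX star aP deg_inner deg_star.
have [|b [bP b_eq leaves_inner]] :=
  @reserve_leaves k I (I :|: S) (I :\: X) a (subsetUl _ _) (subsetDl _ _) aP.
  move=> i iI; have := deg_inner i iI; have := cardsID (I :|: S) (nbrs E i).
  by have := subset_leq_card (subsetIr (nbrs E i) (I :|: S)); rewrite card_nbrs; lia.
have [T [sT T_leaf T_inner T_star]] := framed_tree cI XI rX star bP.
exists T => // v /andP[v2 vk]; have [vI|vI] := boolP (v \in I); last first.
  by rewrite T_leaf in v2.
move: vk; rewrite leqNgt => /negP; apply; have [vX|vX] := boolP (v \in X); last first.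
  have vIX : v \in I :\: X by rewrite inE vX.
  apply: leq_ltn_trans (T_inner v vIX); apply: leq_trans (leaves_inner v vIX) _.
  apply: subset_leq_card; apply/subsetP => u; rewrite !inE negb_or.
  by case/andP=> /andP[-> _].
apply: leq_trans (deg_star v vX) (leq_trans _ (T_star v vX)); rewrite !leq_add2r.
apply: subset_leq_card; apply/subsetP => u; rewrite !inE => /andP[/andP[-> au] uS].
by rewrite b_eq // inE uS orbT.
Qed.

Lemma rooted_2k_ST k I c : connected_on E I -> c \in I -> dominating E I setT ->
  k < degree E c -> (forall i, i \in I -> i != c -> k.+1 * #|I| <= degree E i) ->
  has_2k_ST k E.
Proof.
move=> cI cIn domI kc deg_inner; have [f fP] := dominating_attaches domI.
pose N := nbrs E c :&: I.
have [|S SN cS] := @subset_of_card _ (nbrs E c :\: I) (k.+1 - #|N|).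
  by have := cardsID I (nbrs E c); rewrite card_nbrs -/N; lia.
have SP v : v \in S -> v \notin I /\ E c v.
  by move=> /(subsetP SN); rewrite inE in_nbrs => /andP[].
pose a v := if v \in S then c else f v.
apply: (@framed_2k_ST k I [set c] S c a) => //.
- by rewrite sub1set.
- exact: set11.
- by move=> x /set1P ->; rewrite eqxx.
- by move=> v vT vI; rewrite /a; case: ifP => [/SP[]//|_]; exact: fP.
- move=> i /setDP[iI]; rewrite inE => ic.
  have N0 : 0 < #|N|.
    have iN : i \notin [set c] by rewrite inE.
    have [u [v [/setIP[_ /set1P->] /setDP[vI _] cv]]] :=
      connected_on_exit sE cI cIn iI (set11 c) iN.
    by apply/card_gt0P; exists v; rewrite inE in_nbrs cv.
  have := deg_inner i iI ic; have := cardsUI I S; have := cardsD1 c I.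
  by rewrite cIn; nia.
move=> x /set1P ->; rewrite eqxx cards1 addn0.
have -> : private_nbrs E [set c] c :&: I = N.
  apply/setP => u; rewrite !inE; case uI: (u \in I); rewrite ?andbF // !andbT.
  have [->|uc] := eqVneq u c; first by rewrite iE.
  rewrite /= (sE c); apply/eqP/idP => [/setP/(_ c)|uc'].
    by rewrite !inE eqxx andbT.
  by apply/setP => v; rewrite !inE andbC; case: eqVneq => // ->.
have -> : leaves I a c :&: S = S.
  apply/setIidPr/subsetP => v vS; rewrite inE /a vS eqxx.
  by case: (SP v vS) => ->.
by rewrite cS; lia.
Qed.

Lemma two_rooted_2k_ST k I q1 q2 : connected_on E I -> q1 \in I -> q2 \in I ->
  E q1 q2 -> dominating E I setT ->
  let p q := #|private_nbrs E [set q1; q2] q :&: I| in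
  k - p q1 <= #|nbrs E q1 :\: I| -> k - p q2 <= #|nbrs E q2 :\: I| ->
  (k - p q1) + (k - p q2) <= #|(nbrs E q1 :|: nbrs E q2) :\: I| ->
  (forall i, i \in I -> i \notin [set q1; q2] -> k.+1 * #|I| <= degree E i) ->
  has_2k_ST k E.
Proof.
move=> cI q1I q2I q12 domI p le1 le2; rewrite setDUl => le12 deg_inner.
have q1q2 : q1 != q2 by apply: contraTneq q12 => ->; rewrite iE.
have [f fP] := dominating_attaches domI.
have [S1 [S2 [S1N S2N dS cS1 cS2]]] := disjoint_subsets_of_card le1 le2 le12.
have S1P v : v \in S1 -> v \notin I /\ E q1 v.
  by move=> /(subsetP S1N); rewrite inE in_nbrs => /andP[].
have S2P v : v \in S2 -> v \notin I /\ E q2 v.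
  by move=> /(subsetP S2N); rewrite inE in_nbrs => /andP[].
pose a v := if v \in S1 then q1 else if v \in S2 then q2 else f v.
have XI : [set q1; q2] \subset I by rewrite subUset !sub1set q1I.
apply: (@framed_2k_ST k I [set q1; q2] (S1 :|: S2) q1 a) => //.
- by rewrite !inE eqxx.
- by move=> x /set2P[]->; rewrite ?eqxx.
- move=> v vT vI; rewrite /a; case: ifP => [/S1P[]//|_].
  by case: ifP => [/S2P[]//|_]; exact: fP.
- move=> i /setDP[iI iX]; have := deg_inner i iI iX.
  have := (leq_card_setU I (S1 :|: S2)).1; have := (leq_card_setU S1 S2).1.
  have := leq_subr (p q1) k; have := leq_subr (p q2) k; rewrite -cS1 -cS2.
  rewrite -(cardsID [set q1; q2] I) (setIidPr XI) cards2 q1q2.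
  move: #|I :|: _| #|S1 :|: S2| => x y.
  by lia.
have leaves1 : S1 \subset leaves I a q1 :&: (S1 :|: S2).
  by apply/subsetP => v vS; rewrite !inE /a vS eqxx; case: (S1P v vS) => ->.
have leaves2 : S2 \subset leaves I a q2 :&: (S1 :|: S2).
  apply/subsetP => v vS; rewrite !inE /a (disjointFl dS vS) vS eqxx orbT.
  by case: (S2P v vS) => ->.
move=> x xX; rewrite cards2 q1q2 if_same addn1 ltnS addnC -leq_subLR.
by case/set2P: xX => ->; rewrite -/(p _) -?cS1 -?cS2 subset_leq_card.
Qed.

End PrescribedInnerVertices.

(** * Small connected dominating sets *)

Section Domination.
Variables (V : finType) (E : rel V).
Hypothesis sE : symmetric E.
Hypothesis iE : irreflexive E.
Implicit Types (A C D I P S W X Y : {set V}).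

Lemma card_setI_sum A W : #|A :&: W| = \sum_(w in W) (w \in A).
Proof.
rewrite -sum1_card (eq_bigl (fun x => (x \in W) && (x \in A))); last first.
  by move=> x; rewrite inE andbC.
by rewrite big_mkcondr; apply: eq_bigr => x _; case: (x \in A).
Qed.

Lemma sum_card_nbrs_exchange P W :
  \sum_(x in P) #|nbrs E x :&: W| = \sum_(w in W) #|nbrs E w :&: P|.
Proof.
under eq_bigr do rewrite card_setI_sum.
rewrite exchange_big; apply: eq_bigr => w _; rewrite card_setI_sum.
by apply: eq_bigr => x _; rewrite !in_nbrs sE.
Qed.

Lemma leq_sum_card_nbrs P W th :
  (forall w, w \in W -> th <= #|nbrs E w :&: P|) ->
  #|W| * th <= \sum_(x in P) #|nbrs E x :&: W|.
Proof.
by move=> W_th; rewrite sum_card_nbrs_exchange -sum_nat_const; exact: leq_sum.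
Qed.

Lemma exists_mean_nbrs P W th : 0 < #|P| ->
  (forall w, w \in W -> th <= #|nbrs E w :&: P|) ->
  exists2 x, x \in P & th * #|W| <= #|P| * #|nbrs E x :&: W|.
Proof.
move=> P0 W_th; apply: contrapT => no.
have : \sum_(x in P) (#|P| * #|nbrs E x :&: W|).+1 <= \sum_(x in P) th * #|W|.
  by apply: leq_sum => x xP; rewrite ltnNge; apply/negP => le; apply: no; exists x.
rewrite sum_nat_const; under eq_bigr do rewrite -addn1.
rewrite big_split /= -big_distrr /= sum1_card.
have := leq_mul (leqnn #|P|) (leq_sum_card_nbrs W_th).
by move: (\sum_(x in P) _) => s; lia.
Qed.

Definition undominated Y D : {set V} := [set y in Y | nbrs E y :&: D == set0].

Lemma card_undominated_setU1 Y D x :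
  #|undominated Y (x |: D)| + #|nbrs E x :&: undominated Y D| <= #|undominated Y D|.
Proof.
rewrite -(cardsID (nbrs E x) (undominated Y D)) setIC addnC leq_add2l.
apply: subset_leq_card; apply/subsetP => y; rewrite !inE => /andP[-> /eqP y0].
have ny z : z \in x |: D -> ~~ E y z.
  by move=> zD; have := in_set0 z; rewrite -y0 inE in_nbrs zD andbT => ->.
rewrite sE ny ?setU11 //=; apply/eqP/setP => z; rewrite !inE.
by apply/negP => /andP[yz zD]; move: (ny z); rewrite setU1r // yz => /(_ isT).
Qed.

(* Each greedy step keeps at most the fraction [a / b] of [Y] undominated. *)
Lemma greedy_domination P Y th a b m : 0 < #|P| ->
  (forall y, y \in Y -> th <= #|nbrs E y :&: P|) ->
  b * #|P| <= b * th + a * #|P| ->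
  exists D, [/\ D \subset P, #|D| <= m
    & #|undominated Y D| * b ^ m <= #|Y| * a ^ m].
Proof.
move=> P0 Y_th ab; elim: m => [|m [D [DP Dm IH]]].
  exists set0; rewrite sub0set cards0 !expn0 !muln1; split=> //.
  by apply: subset_leq_card; apply/subsetP => y; rewrite !inE => /andP[].
have [|x xP x_mean] := @exists_mean_nbrs P (undominated Y D) th P0.
  by move=> w; rewrite inE => /andP[wY _]; exact: Y_th.
exists (x |: D); split.
- by rewrite subUset sub1set xP.
- by rewrite cardsU1; case: (x \notin D) => /=; lia.
move: IH x_mean (card_undominated_setU1 Y D x).
set w' := #|undominated Y (x |: D)|; set w := #|undominated Y D|.
move: #|nbrs E x :&: _| P0 ab; move: #|P| => p t p0 ab IH x_mean drop.
have step : b * w' <= a * w.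
  rewrite -(leq_pmul2l p0).
  have := leq_mul (leqnn (b * p)) drop; have := leq_mul ab (leqnn w).
  by have := leq_mul (leqnn b) x_mean; lia.
have := leq_mul step (leqnn (b ^ m)); have := leq_mul (leqnn a) IH.
by rewrite !expnS; lia.
Qed.

(* Ore: an inclusion-minimal dominating set and its complement both dominate. *)
Lemma half_domination A C :
  (forall x, x \in A -> exists2 y, y \in A :|: C & E x y) ->
  exists S, [/\ S \subset A, 2 * #|S| <= #|A| & dominating E (S :|: C) A].
Proof.
move=> A_nbr; pose dom S := `[< dominating E (S :|: C) A >].
have domA : dom A by apply/asboolP => x xA; rewrite inE xA.
have [S /minsetP[/asboolP domS minS] SA] := minset_exists domA.
have outer s : s \in S -> exists2 y, y \in (A :\: S) :|: C & E y s.
  move=> sS; apply: contrapT => no.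
  have inS y : y \in A :|: C -> E y s -> y \in S.
    move=> yAC ys; apply: contrapT => /negP yS; apply: no; exists y => //.
    by move: yAC; rewrite !inE yS.
  suff /minS /(_ (subsetDl _ _)) /setP/(_ s) : dom (S :\ s) by rewrite !inE eqxx sS.
  apply/asboolP => x xA; rewrite !inE negb_or => /andP[xSs xC].
  have [xs|xs] := eqVneq x s.
    have [y yAC] := A_nbr x xA; rewrite xs sE => ys; exists y => //.
    by rewrite !inE (inS y) // andbT; case: eqVneq ys => // ->; rewrite iE.
  rewrite xs in xSs; have [|y ySC yx] := domS x xA; first by rewrite !inE negb_or xSs.
  exists y => //; move: ySC; rewrite !inE => /orP[yS|->]; rewrite ?orbT // yS andbT.
  have [yE|//] := eqVneq y s; case/negP: xSs; apply: inS; rewrite ?inE ?xA //.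
  by rewrite sE -yE.
have cA := cardsID S A; rewrite (setIidPr SA) in cA.
have [le|lt] := leqP (2 * #|S|) #|A|; first by exists S.
exists (A :\: S); split; [exact: subsetDl | lia | move=> x xA xAS].
by apply: outer; move: xAS; rewrite !inE xA andbT negb_or negbK => /andP[].
Qed.

Section ConnectedDomination.
Variables (P : {set V}) (c : V) (th : nat).
Hypothesis cP : c \in P.
Hypothesis connP : connected_on E P.

Definition far : {set V} := P :\: (c |: nbrs E c).

Hypothesis far_th : forall y, y \in far -> th <= #|nbrs E y :&: P|.

(* [c |: S] meets every component of the subgraph induced on [I]. *)
Definition spanned_by I S : Prop :=
  [/\ I \subset P, c \in I, dominating E I P
    & forall i, i \in I -> exists2 s, s \in c |: S & i \in component E I s].

Lemma spanned_by_extend I S s s' X : spanned_by I S -> s' \in S ->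
  s \in c |: S -> s != s' -> X \subset P -> s' |: X \subset component E (I :|: X) s ->
  spanned_by (I :|: X) (S :\ s').
Proof.
move=> [IP cI domI spanI] s'S sS ss' XP /subsetP merged.
have sS' : s \in c |: S :\ s' by move: sS; rewrite !inE ss'.
split; [by rewrite subUset IP | by rewrite inE cI | |].
  move=> v vP; rewrite inE negb_or => /andP[/(domI v vP)[u uI uv] _].
  by exists u; rewrite // inE uI.
move=> i /setUP[/spanI[t tS]|iX]; last first.
  by exists s => //; apply: merged; rewrite inE iX orbT.
rewrite inE => /(connect_induced_sub (subsetUl I X)) ti.
have [ts'|ts'] := eqVneq t s'; last first.
  by exists t; rewrite inE //; move: tS; rewrite !inE ts'.
exists s => //; rewrite inE; apply: connect_trans ti.
by have := merged s' (setU11 _ _); rewrite inE ts'.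
Qed.

Lemma exists_common_nbr q S : #|P| < q * th -> S \subset far -> q <= #|S| ->
  exists x s s', [/\ x \in P, s \in S, s' \in S, s != s' & E x s && E x s'].
Proof.
move=> Pq Sfar qS; apply: contrapT => no.
have : \sum_(x in P) #|nbrs E x :&: S| <= \sum_(x in P) 1.
  apply: leq_sum => x xP; rewrite leqNgt; apply/negP => /card_gt1P[s [s' []]].
  rewrite !inE => /andP[xs sS] /andP[xs' s'S] ss'; apply: no.
  by exists x, s, s'; split; rewrite ?xs.
rewrite sum1_card; have := @leq_sum_card_nbrs P S th.
have := leq_mul qS (leqnn th).
move=> qth /(_ (fun w wS => far_th (subsetP Sfar w wS))) Sth sP.
by have := leq_ltn_trans (leq_trans qth (leq_trans Sth sP)) Pq; rewrite ltnn.
Qed.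

Lemma merge_common_nbrs q I S : #|P| < q * th -> spanned_by I S -> S \subset far ->
  S \subset I -> exists I' S',
  [/\ spanned_by I' S', #|S'| < q & #|I'| + #|S'| <= #|I| + #|S|].
Proof.
move=> Pq; have [m] := ubnP #|S|; elim: m I S => // m IH I S.
rewrite ltnS => Sm spI Sfar SI; have [qS|Sq] := leqP q #|S|; last by exists I, S.
have [x [s [s' [xP sS s'S ss' /andP[xs xs']]]]] := exists_common_nbr Pq Sfar qS.
have xX : x \in I :|: [set x] by rewrite !inE eqxx orbT.
have inX y : y \in S -> y \in I :|: [set x] by move=> /(subsetP SI); rewrite inE => ->.
have sx : connect (induced E (I :|: [set x])) s x.
  by apply: connect1; rewrite /= inX // xX sE.
have spI' : spanned_by (I :|: [set x]) (S :\ s').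
  apply: (spanned_by_extend spI s'S _ ss'); rewrite ?inE ?sS ?orbT ?sub1set //.
  apply/subsetP => z /set2P[]->; rewrite inE //; apply: connect_trans sx _.
  by apply: connect1; rewrite /= xX inX.
have cS : #|S| = #|S :\ s'|.+1 by rewrite [LHS](cardsD1 s') s'S.
have [|||I' [S' [spI'' S'q cI']]] := IH _ _ _ spI'.
- by rewrite -cS.
- exact: subset_trans (subsetDl _ _) Sfar.
- exact: subset_trans (subsetDl _ _) (subset_trans SI (subsetUl _ _)).
exists I', S'; split=> //; apply: leq_trans cI' _; rewrite cS addnS -addSn leq_add2r.
by rewrite (leq_trans (leq_card_setU _ _).1) // cards1 addn1.
Qed.

(* [X] is the interior of a path of length at most 3 from the component of [c] to
   [w]. *)
Lemma exists_bridge I : I \subset P -> c \in I -> dominating E I P ->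
  ~ (I \subset component E I c) ->
  exists X w, [/\ X \subset P, #|X| <= 2, w \in I, w \notin component E I c
    & w |: X \subset component E (I :|: X) c].
Proof.
move=> IP cI domI /negP/subsetPn[i iI iC]; set C := component E I c in iC *.
have cC : c \in C by exact: component_self.
pose N := C :|: [set v in P | [exists u in C, E u v]].
have stepC u v : u \in C -> v \in I -> E u v -> v \in C by exact: component_step.
have iN : i \notin N.
  rewrite in_setU (negPf iC) inE; apply/negP => /andP[_ /exists_inP[u uC ui]].
  by rewrite (stepC u i) in iC.
have [|x [y [/setIP[xP xN] /setDP[yP yN] xy]]] :=
  connected_on_exit sE connP cP (subsetP IP _ iI) (_ : c \in N) iN.
  by rewrite inE cC.
have yC u : u \in C -> ~~ E u y.
  move=> uC; apply: contraNN yN => uy; rewrite inE; apply/orP; right.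
  by rewrite inE yP; apply/exists_inP; exists u.
pose X := [set x; y]; have sub := subsetUl I X.
have cx : connect (induced E (I :|: X)) c x.
  case/setUP: xN => [|]; rewrite inE; first exact: connect_induced_sub.
  move=> /andP[_ /exists_inP[u uC ux]]; have uI := subsetP (component_sub E cI) u uC.
  move: uC; rewrite inE => /(connect_induced_sub sub) cu; apply: connect_trans cu _.
  by apply: connect1; rewrite /= !inE uI ux eqxx orbT.
have cy : connect (induced E (I :|: X)) c y.
  by apply: connect_trans cx _; apply: connect1; rewrite /= !inE !eqxx xy !orbT.
have [w wI [cw wC]] :
    exists2 w, w \in I & connect (induced E (I :|: X)) c w /\ w \notin C.
  have [yI|/(domI y yP)[w wI wy]] := boolP (y \in I).
    by exists y => //; split=> //; apply: contraNN yN => yC'; rewrite inE yC'.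
  exists w => //; split; last by apply: contraTN wy => /yC.
  by apply: connect_trans cy _; apply: connect1; rewrite /= !inE wI eqxx sE wy !orbT.
exists X, w; split=> //; first by rewrite subUset !sub1set xP.
  by rewrite cards2; case: (_ != _).
by apply/subsetP => z; rewrite !inE => /or3P[]/eqP->.
Qed.

Lemma merge_components I S : spanned_by I S -> exists I',
  [/\ c \in I', I' \subset P, dominating E I' P, connected_on E I'
    & #|I'| <= #|I| + 2 * #|S|].
Proof.
have [m] := ubnP #|S|; elim: m I S => // m IH I S; rewrite ltnS => Sm spI.
have [IP cI domI spanI] := spI.
have [conn|/negP disc] := boolP (I \subset component E I c).
  exists I; split=> //; last by rewrite leq_addr.
  exact: connected_on_sub_component cI conn.
have [X [w [XP X2 wI wC /subsetP wX]]] := exists_bridge IP cI domI disc.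
have [s /setU1P[->|sS]] := spanI w wI; first by rewrite (negPf wC).
move=> sw; have sc : c != s by apply: contraNneq wC => ->.
have cS : #|S| = #|S :\ s|.+1 by rewrite [LHS](cardsD1 s) sS.
have spI' : spanned_by (I :|: X) (S :\ s).
  apply: (spanned_by_extend spI sS (setU11 _ _) sc XP).
  apply/subsetP => z /setU1P[->|zX]; last by apply: wX; rewrite inE zX orbT.
  have := wX w (setU11 _ _); rewrite !inE => cw; apply: connect_trans cw _.
  rewrite (sym_connect_sym (induced_sym sE _)).
  by rewrite inE in sw; exact: connect_induced_sub (subsetUl _ _) sw.
have [|I' [cI' I'P domI' connI' cardI']] := IH _ _ _ spI'; first by rewrite -cS.
exists I'; split=> //; apply: leq_trans cardI' _; rewrite cS mulnS addnA leq_add2r.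
by apply: leq_trans (leq_card_setU _ _).1 _; rewrite leq_add2l.
Qed.

Lemma exists_spanned_by D : D \subset P ->
  (forall y, y \in far -> exists2 x, x \in D & E y x) ->
  exists S, [/\ S \subset D, S \subset far, 2 * #|S| <= #|D| & spanned_by (c |: D) S].
Proof.
move=> DP far_dom.
have near v : v \in P -> v \notin far -> v != c -> E c v.
  by rewrite !inE => -> ; rewrite andbT negbK => /orP[->|].
have [|S [SD S2 domS]] := @half_domination (D :&: far) (D :\: far).
  by move=> x /setIP[_ /far_dom[y yD xy]]; exists y => //; rewrite setID.
have [SsD Sfar] : S \subset D /\ S \subset far by apply/andP; rewrite -subsetI.
have near_c x : x \in D -> x \notin far -> x \in component E (c |: D) c.
  move=> xD xF; have [->|xc] := eqVneq x c; first exact: component_self.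
  rewrite inE connect1 //= !inE eqxx xD near ?orbT //; exact: (subsetP DP).
exists S; split=> //.
  by apply: leq_trans S2 _; rewrite subset_leq_card // subsetIl.
split; [by rewrite subUset sub1set cP | exact: setU11 | |].
  move=> v vP; rewrite !inE negb_or => /andP[vc vD].
  have [/far_dom[x xD vx]|vF] := boolP (v \in far).
    by exists x; rewrite ?(sE x) // inE xD orbT.
  by exists c; [exact: setU11 | exact: near].
move=> i /setU1P[->|iD]; first by exists c; rewrite ?setU11 ?component_self.
have [iF|iF] := boolP (i \in far); last by exists c; rewrite ?setU11 ?near_c.
have [iS|iS] := boolP (i \in S).
  by exists i; rewrite ?component_self // inE iS orbT.
have step y : y \in D -> E y i -> induced E (c |: D) y i.
  by move=> yD yi; rewrite /= !inE yD iD yi !orbT.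
have iDF : i \in D :&: far by rewrite inE iD.
have iSC : i \notin S :|: D :\: far by rewrite !in_setU in_setD iF (negPf iS).
have [y /setUP[yS|/setDP[yD yF]] yi] := domS i iDF iSC.
  exists y; first by rewrite inE yS orbT.
  by rewrite inE connect1 // step // (subsetP SsD).
exists c; rewrite ?setU11 //; have := near_c y yD yF; rewrite !inE => cy.
by apply: connect_trans cy _; rewrite connect1 // step.
Qed.

Lemma connected_domination W a b m q : W \subset P ->
  b * #|P| <= b * th + a * #|P| -> #|P| < q * th -> #|P| * a ^ m < b ^ m ->
  exists I, [/\ c |: W \subset I, I \subset P, dominating E I P, connected_on E I
    & #|I| <= m + m./2 + q + #|W|].
Proof.
move=> WP ab Pq Pm; have P0 : 0 < #|P| by apply/card_gt0P; exists c.
have [D [DP Dm und]] := @greedy_domination P far th a b m P0 far_th ab.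
have far_dom y : y \in far -> exists2 x, x \in D & E y x.
  move=> yF; have [y0|/set0Pn[x]] := eqVneq (nbrs E y :&: D) set0; last first.
    by rewrite inE in_nbrs => /andP[yx xD]; exists x.
  have : 0 < #|undominated far D| by apply/card_gt0P; exists y; rewrite inE yF y0 eqxx.
  have farP : #|far| <= #|P| by rewrite subset_leq_card // subsetDl.
  have := leq_mul farP (leqnn (a ^ m)).
  by move: und Pm; clear; nia.
have [S [SD Sfar S2 spS]] := exists_spanned_by DP far_dom.
have [I1 [S1 [spI1 S1q cardI1]]] :=
  merge_common_nbrs Pq spS Sfar (subset_trans SD (subsetUr _ _)).
have [I [cI IP domI connI cardI]] := merge_components spI1.
have domW : dominating E I W by move=> w /(subsetP WP); exact: domI.
exists (I :|: W); split.
- by rewrite setSU // sub1set.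
- by rewrite subUset IP.
- move=> v vP; rewrite inE negb_or => /andP[/(domI v vP)[u uI uv] _].
  by exists u; rewrite // inE uI.
- exact: connected_on_dominated.
apply: leq_trans (leq_card_setU _ _).1 _; rewrite leq_add2r.
have : #|c |: D| <= #|D|.+1 by rewrite cardsU1; case: (c \notin D).
by move: cardI cardI1 S1q S2 Dm; clear; lia.
Qed.

End ConnectedDomination.
End Domination.

(** * Blocking sets *)

Section Blocking.
Variables (V : finType) (E : rel V) (k : nat).
Hypothesis sE : symmetric E.
Implicit Types (A U W : {set V}).

Lemma degree_sub (T : rel V) v : subrel T E -> degree T v <= degree E v.
Proof.
by move=> TE; apply: subset_leq_card; apply/subsetP => u; rewrite !inE; exact: TE.
Qed.

Lemma not_cutset_connected_on U : ~ cutset E U <-> connected_on E (~: U).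
Proof.
have eq_del : delete_vertices E U =2 induced E (~: U).
  by move=> x y; rewrite /= !inE.
split=> [no x y|conn [x [y [xU yU]]]].
  rewrite !inE => xU yU; rewrite -(eq_connect eq_del).
  by apply: contrapT => nc; apply: no; exists x, y.
by rewrite (eq_connect eq_del); apply; apply: conn; rewrite inE.
Qed.

Lemma has_2k_ST_no_blocking_set : has_2k_ST k E -> ~ exists U, blocking_set k E U.
Proof.
move=> [T [[sT _] TE [_ cT] _] dT] [U [+ dU]].
apply/not_cutset_connected_on => x y xU yU.
have connT : connected_on T setT.
  by move=> u v _ _; rewrite (@eq_connect _ _ T) // => w z; rewrite /= !inE.
have leafU v : v \in U -> #|nbrs T v :&: setT| <= 1.
  rewrite setIT card_nbrs => /dU /andP[_ vk]; rewrite leqNgt; apply/negP => v2.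
  by apply: (dT v); rewrite v2 (leq_trans (degree_sub v TE)).
have := connected_on_setD_leaves sT connT leafU; rewrite setTD => /(_ x y xU yU).
apply: connect_sub => u v /and3P[uU vU uv].
by apply: connect1; rewrite /= uU vU TE.
Qed.

Definition small : {set V} := [set v | degree E v <= k].

Hypothesis noblock : ~ exists U, blocking_set k E U.

Lemma connected_on_setC_small W : W \subset small -> connected_on E (~: W).
Proof.
move=> /subsetP Wsmall; pose U := [set u in W | 2 <= degree E u].
have connU : connected_on E (~: U).
  apply/not_cutset_connected_on => cut; apply: noblock; exists U; split=> // u.
  by rewrite inE => /andP[/Wsmall]; rewrite inE => ->; rewrite andbT.
have -> : ~: W = ~: U :\: (W :\: U).
  by apply/setP => v; rewrite !inE; case: (v \in W); case: (2 <= _).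
apply: connected_on_setD_leaves => // v /setDP[vW].
rewrite inE vW -leqNgt; apply: leq_trans.
by rewrite -card_nbrs subset_leq_card // subsetIl.
Qed.

Lemma dominating_setC_small v : v \notin small -> dominating E (~: small) setT.
Proof.
move=> vS p _; rewrite in_setC negbK => pS.
have pW : p \in ~: (small :\ p) by rewrite !inE eqxx.
have vW : v \in ~: (small :\ p) by rewrite in_setC in_setD1 (negPf vS) andbF.
have vp : v \notin [set p] by rewrite inE; apply: contraNneq vS => ->.
have connW := connected_on_setC_small (subsetDl small [set p]).
have [u [w [/setIP[_ /set1P->] /setDP[+ wp] pw]]] :=
  connected_on_exit sE connW pW vW (set11 p) vp.
rewrite in_setC in_setD negb_and negbK (negPf wp) /= => wS.
by exists w; rewrite 1?sE // in_setC.
Qed.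

End Blocking.

(** * Construction of the spanning tree *)

Section Construction.
Variables (V : finType) (E : rel V) (k : nat).
Hypothesis sE : symmetric E.
Hypothesis iE : irreflexive E.
Hypothesis k2 : 2 <= k.
Hypothesis order_large : large_order k #|V|.
Hypothesis ore : forall u v, u != v -> ~~ E u v ->
  #|V| + 2 * k <= 2 * (degree E u + degree E v) + 2.
Hypothesis noblock : ~ exists U, blocking_set k E U.
Implicit Types (C I P W : {set V}) (q u v w : V).

Notation n := #|V|.
Notation B := (small E k).

Definition poor : {set V} := [set v | degree E v < n %/ 10].
Notation Q := poor.

Lemma order_ge : 64 * k * k <= n.
Proof.
have [j kj] : exists j, k = j.+2 by exists (k - 2); lia.
by move: order_large; rewrite /large_order kj /= -mulnn; clear; nia.
Qed.

Lemma k_lt_tenth : k < n %/ 10.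
Proof. by have := order_ge; nia. Qed.

Lemma small_sub_poor : B \subset Q.
Proof.
by apply/subsetP => v; rewrite !inE => /leq_ltn_trans; apply; exact: k_lt_tenth.
Qed.

Lemma degree_notin_poor v : v \notin Q -> n %/ 10 <= degree E v.
Proof. by rewrite inE -leqNgt. Qed.

Lemma poor_clique u v : u \in Q -> v \in Q -> u != v -> E u v.
Proof.
rewrite !inE => uQ vQ uv; apply: contrapT => /negP nuv; have := ore uv nuv.
by lia.
Qed.

Lemma card_poor_le_degree q : q \in Q -> #|Q| <= (degree E q).+1.
Proof.
move=> qQ; rewrite (cardsD1 q) qQ add1n ltnS; apply: subset_leq_card.
by apply/subsetP => v /setD1P[vq vQ]; rewrite inE poor_clique // eq_sym.
Qed.

Lemma card_poor_le : #|Q| <= n %/ 10.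
Proof.
have [->|[q qQ]] := set_0Vmem Q; first by rewrite cards0.
by apply: leq_trans (card_poor_le_degree qQ) _; move: qQ; rewrite inE.
Qed.

Lemma card_small_le : #|B| <= k.+1.
Proof.
have [->|[q qB]] := set_0Vmem B; first by rewrite cards0.
apply: leq_trans (subset_leq_card small_sub_poor) _.
apply: leq_trans (card_poor_le_degree (subsetP small_sub_poor _ qB)) _.
by move: qB; rewrite inE.
Qed.

Lemma degree_nonadjacent_poor q v : q \in Q -> q != v -> ~~ E q v ->
  n + 2 * k <= 2 * (degree E v + n %/ 10).
Proof. by rewrite inE => qQ qv /(ore qv); lia. Qed.

Lemma card_setC_poor_ge : 5 * n <= 6 * #|~: Q|.
Proof. by have := cardsC Q; have := card_poor_le; move: #|Q| #|~: Q|; lia. Qed.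

(* Either [c] sees a seventh of the graph, or the vertices that are not adjacent
   to [c] see more than a third of it. *)
Lemma exists_domination_steps c : n %/ 10 <= degree E c -> exists th a b m,
  [/\ forall y, y != c -> ~~ E c y -> degree E c <= degree E y ->
        th + #|B| <= degree E y,
      b * #|~: B| <= b * th + a * #|~: B|, #|~: B| < 5 * th,
      n * a ^ m < b ^ m & k.+1 * (m + m./2 + k + 6) <= degree E c].
Proof.
move=> c_ge; have Bk := card_small_le; have n_ge := order_ge; have cB := cardsC B.
have k_lt : 128 * k <= n by nia.
have far_degree y : y != c -> ~~ E c y ->
    n + 2 * k <= 2 * (degree E y + degree E c) + 2.
  by move=> yc cy; apply: ore; rewrite // sE.
have [big|lt] := leqP n (7 * degree E c).
  have [m nm le_n] := large_order_greedy_steps_19_25 k2 order_large.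
  exists ((n + 2 * k - 2) %/ 4 - #|B|), 19, 25, m; split=> //; try lia.
  by move=> y yc cy; have := far_degree y yc cy; lia.
have [m nm le_n] := large_order_greedy_steps_2_3 k2 order_large.
exists ((n + 2 * k - 2) %/ 2 - degree E c - #|B|), 2, 3, m; split=> //; try lia.
by move=> y yc cy; have := far_degree y yc cy; lia.
Qed.

Lemma poor_sub_small_2k_ST : Q \subset B -> has_2k_ST k E.
Proof.
move=> QB; have [c0 c0B] : exists c, c \in ~: B.
  apply/card_gt0P; have := cardsC B; have := card_small_le; have := order_ge.
  by move: #|B| #|~: B|; clear -k2; nia.
have [c cB c_min] := @arg_minnP _ c0 (mem (~: B)) (degree E) c0B.
have {}cB : c \in ~: B := cB.
have c_ge : n %/ 10 <= degree E c.
  apply: degree_notin_poor; apply: contraTN cB => /(subsetP QB).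
  by rewrite in_setC negbK.
have [th [a [b [m [far_degree ab Pq nm le_c]]]]] := exists_domination_steps c_ge.
have connP := connected_on_setC_small sE noblock (subxx B).
have far_th y : y \in far E (~: B) c -> th <= #|nbrs E y :&: ~: B|.
  case/setDP=> yB; rewrite !inE negb_or => /andP[yc cy].
  have := far_degree y yc cy (c_min y yB); have := degree_le_nbrsI E (~: B) y.
  by rewrite setCK; lia.
have domB : dominating E (~: B) setT.
  by apply: (dominating_setC_small sE noblock (v := c)); rewrite -in_setC.
have [f fP] := dominating_attaches domB.
have fB v : v \in B -> f v \in ~: B /\ E (f v) v.
  by move=> vB; apply: fP; rewrite // in_setC negbK.
pose W := f @: B.
have WP : W \subset ~: B by apply/subsetP => w /imsetP[v /fB[fv _] ->].
have [|I [cWI IP domI connI cardI]] :=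
  connected_domination sE iE cB connP far_th WP ab Pq (m := m).
  exact: leq_ltn_trans (leq_mul (max_card _) (leqnn _)) nm.
have [cI /subsetP WI] : c \in I /\ W \subset I.
  by apply/andP; rewrite -sub1set -subUset.
apply: (rooted_2k_ST sE iE connI cI).
- move=> v _ vI; have [vB|vB] := boolP (v \in B); last by apply: domI; rewrite // inE.
  by exists (f v); [apply: WI; exact: imset_f | case: (fB v vB)].
- exact: leq_trans k_lt_tenth c_ge.
move=> i iI _; apply: leq_trans (c_min i (subsetP IP i iI)).
apply: leq_trans le_c; rewrite leq_mul2l /=; apply: leq_trans cardI _.
have := leq_trans (leq_imset_card f B) card_small_le; rewrite -/W.
by lia.
Qed.

Lemma poor_connected_domination q P W : q \in Q -> q \in P -> ~: Q \subset P ->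
  connected_on E P -> W \subset P -> #|W| <= k.+1 -> exists I,
  [/\ q |: W \subset I, I \subset P, connected_on E I, dominating E I setT
    & k.+1 * #|I| <= n %/ 10].
Proof.
move=> qQ qP QP connP WP Wk.
have [m nm le_m] := large_order_greedy_steps_2_3 k2 order_large.
have cP := cardsC P; have Qn := card_poor_le.
have PQ : #|~: P| < #|Q|.
  apply: proper_card; rewrite properE subCset QP.
  by apply/subsetPn; exists q; rewrite // inE qP.
pose th := (n + 2 * k) %/ 2 - n %/ 10 - #|~: P|.
have far_th y : y \in far E P q -> th <= #|nbrs E y :&: P|.
  case/setDP=> yP; rewrite !inE negb_or eq_sym => /andP[qy nqy].
  have := degree_nonadjacent_poor qQ qy nqy; have := degree_le_nbrsI E P y.
  by rewrite /th; lia.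
have [|||I [qWI IP domI connI cardI]] :=
  @connected_domination _ _ sE iE P q th qP connP far_th W 2 3 m 5 WP.
- by rewrite /th; lia.
- by rewrite /th; lia.
- exact: leq_ltn_trans (leq_mul (max_card _) (leqnn _)) nm.
have qI : q \in I by apply: (subsetP qWI); exact: setU11.
exists I; split=> //.
  move=> v _ vI; have [vQ|vQ] := boolP (v \in Q).
    by exists q => //; apply: poor_clique => //; apply: contraNneq vI => <-.
  by apply: domI => //; apply: (subsetP QP); rewrite inE.
by apply: leq_trans le_m; rewrite leq_mul2l /=; lia.
Qed.

(* Only the root [q] is poor; its own neighbours supply its [k.+1] children. *)
Lemma one_poor_root_2k_ST q : q \in Q -> q \notin B -> connected_on E (q |: ~: Q) ->
  has_2k_ST k E.
Proof.
move=> qQ qB connP.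
have [|I [qI IP connI domI cardI]] := poor_connected_domination qQ (setU11 _ _)
  (subsetUr _ _) connP (sub0set _) _; first by rewrite cards0.
rewrite setU0 sub1set in qI; apply: (rooted_2k_ST sE iE connI qI domI).
  by move: qB; rewrite inE -ltnNge.
move=> i iI iq; apply: leq_trans cardI _; apply: degree_notin_poor.
by have := subsetP IP i iI; rewrite !inE (negPf iq).
Qed.

Lemma card_private_nbrs_ge q q' I : q \in Q -> q' \in Q ->
  (forall v, v \notin Q -> ~~ (E q v && E q' v)) ->
  #|(nbrs E q :\: Q) :&: I| <= #|private_nbrs E [set q; q'] q :&: I|.
Proof.
move=> qQ q'Q disN; apply: subset_leq_card; apply: setSI; apply/subsetP => v.
case/setDP; rewrite in_nbrs => qv vQ; have := disN v vQ; rewrite qv /= => q'v.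
have vX : v \notin [set q; q'] by apply: contraNN vQ => /set2P[]->.
rewrite inE vX; apply/eqP/setP => u; rewrite in_setI in_nbrs sE !inE.
have [->|uq] := eqVneq u q; first by rewrite qv.
by have [->|_] := eqVneq u q'; rewrite ?(negPf q'v) ?andbF.
Qed.

Lemma free_nbrs_ge q q' I : q \notin B -> I :&: Q \subset [set q; q'] ->
  k - #|(nbrs E q :\: Q) :&: I| <= #|nbrs E q :\: I|.
Proof.
rewrite inE -ltnNge => kq IQ.
have : nbrs E q :&: I \subset q' |: (nbrs E q :\: Q) :&: I.
  apply/subsetP => v; rewrite !in_setI in_nbrs => /andP[qv vI].
  rewrite in_setU1 in_setI in_setD in_nbrs qv vI !andbT orbC.
  have [vQ /=|//] := boolP (v \in Q).
  have : v \in I :&: Q by rewrite inE vI.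
  move=> /(subsetP IQ)/set2P[vq|->]; last by rewrite eqxx.
  by rewrite vq iE in qv.
move=> /subset_leq_card; rewrite cardsU1 => le.
by have := cardsID I (nbrs E q); rewrite card_nbrs; case: (_ \notin _) le => /=; lia.
Qed.

Lemma free_nbrs_pair_ge q1 q2 I : q1 \in Q -> q2 \in Q -> q1 != q2 ->
  (forall v, v \notin Q -> ~~ (E q1 v && E q2 v)) -> I :&: Q \subset [set q1; q2] ->
  #|Q| + (#|(nbrs E q1 :\: Q) :\: I| + #|(nbrs E q2 :\: Q) :\: I|)
    <= #|(nbrs E q1 :|: nbrs E q2) :\: I| + 2.
Proof.
move=> q1Q q2Q q12 disN IQ; set Z := (_ :|: _) :\: I.
have XQ : [set q1; q2] \subset Q by rewrite subUset !sub1set q1Q.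
have QZ : Q :\: [set q1; q2] \subset Z :&: Q.
  apply/subsetP => v /setDP[vQ vX].
  rewrite in_setI vQ andbT /Z in_setD in_setU !in_nbrs.
  have -> : v \notin I by apply: contraNN vX => vI; apply: (subsetP IQ); rewrite inE vI.
  by rewrite poor_clique //; apply: contraNneq vX => <-; exact: set21.
have disj : [disjoint (nbrs E q1 :\: Q) :\: I & (nbrs E q2 :\: Q) :\: I].
  rewrite -setI_eq0; apply/eqP/setP => v; rewrite !inE.
  apply/negP => /andP[/and3P[_ vQ q1v] /and3P[_ _ q2v]].
  by have := disN v; rewrite !inE vQ q1v q2v => /(_ isT).
have ZQ : Z :\: Q = (nbrs E q1 :\: Q) :\: I :|: (nbrs E q2 :\: Q) :\: I.
  by rewrite /Z !setDDl (setUC Q) setDUl.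
have := subset_leq_card QZ; have := cardsID [set q1; q2] Q; have := cardsID Q Z.
rewrite ZQ cardsU (disjoint_setI0 disj) cards0 (setIidPr XQ) cards2 q12.
by lia.
Qed.

(* Two adjacent poor roots, each serving the vertices that it alone reaches. *)
Lemma two_poor_roots_2k_ST q1 q2 : q1 \in Q :\: B -> q2 \in Q :\: B -> q1 != q2 ->
  (forall v, v \notin Q -> ~~ (E q1 v && E q2 v)) ->
  connected_on E ([set q1; q2] :|: ~: Q) ->
  (k - #|nbrs E q1 :\: Q|) + (k - #|nbrs E q2 :\: Q|) + 2 <= #|Q| ->
  has_2k_ST k E.
Proof.
move=> /setDP[q1Q q1B] /setDP[q2Q q2B] q12 disN connP count.
have q1P : q1 \in [set q1; q2] :|: ~: Q by rewrite !inE eqxx.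
have q2P : [set q2] \subset [set q1; q2] :|: ~: Q by rewrite sub1set !inE eqxx orbT.
have [|I [qI IP connI domI cardI]] := poor_connected_domination q1Q q1P
  (subsetUr _ _) connP q2P _; first by rewrite cards1.
have [q1I q2I] : q1 \in I /\ q2 \in I by apply/andP; rewrite -!sub1set -subUset.
have IQ : I :&: Q \subset [set q1; q2].
  apply/subsetP => v /setIP[vI vQ]; have := subsetP IP v vI.
  by rewrite in_setU [v \in ~: Q]in_setC vQ orbF.
have IQ' : I :&: Q \subset [set q2; q1] by rewrite setUC.
have disN' v : v \notin Q -> ~~ (E q2 v && E q1 v) by rewrite andbC; exact: disN.
have private1 := card_private_nbrs_ge I q1Q q2Q disN.
have private2 := card_private_nbrs_ge I q2Q q1Q disN'; rewrite setUC in private2.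
apply: (two_rooted_2k_ST sE iE connI q1I q2I (poor_clique q1Q q2Q q12) domI).
- by apply: leq_trans (free_nbrs_ge q1B IQ); exact: leq_sub2l.
- by apply: leq_trans (free_nbrs_ge q2B IQ'); exact: leq_sub2l.
- have := free_nbrs_pair_ge q1Q q2Q q12 disN IQ.
  have := cardsID I (nbrs E q1 :\: Q); have := cardsID I (nbrs E q2 :\: Q).
  move: private1 private2 count; clear.
  move: #|_ :&: I| #|_ :&: I| #|_ :&: I| #|_ :&: I|.
  by lia.
move=> i iI iX; apply: leq_trans cardI _; apply: degree_notin_poor.
by apply: contraNN iX => iQ; apply: (subsetP IQ); rewrite inE iI.
Qed.

Lemma card_component_setC_poor v : Q != set0 -> v \notin Q ->
  #|~: Q| < 3 * #|component E (~: Q) v|.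
Proof.
case/set0Pn => q qQ vQ; set C := component E _ v; have Qn := card_poor_le.
have vR : v \in ~: Q by rewrite in_setC.
have CR : C \subset ~: Q := component_sub E vR.
have nbrC w : w \in C -> nbrs E w \subset C :|: Q.
  move=> wC; apply/subsetP => u; rewrite in_nbrs in_setU => wu.
  have [uQ|uQ] := boolP (u \in Q); first by rewrite orbT.
  by rewrite (component_step vR wC _ wu) // in_setC.
have [y yC qy] : exists2 y, y \in C & ~~ E q y.
  apply: contrapT => no; have : C :|: Q :\ q \subset nbrs E q.
    apply/subsetP => w /setUP[wC|/setD1P[wq wQ]]; rewrite in_nbrs.
      by apply: contrapT => /negP qw; apply: no; exists w.
    by apply: poor_clique; rewrite // eq_sym.
  move=> /subset_leq_card; rewrite card_nbrs.
  have vCQ : v \in C :|: Q by rewrite inE component_self.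
  have := degree_lt_card iE vCQ (nbrC v (component_self _ _ _)).
  have -> : C :|: Q = q |: (C :|: Q :\ q) by rewrite setUCA setD1K.
  rewrite cardsU1; have := degree_notin_poor vQ; move: qQ; rewrite [q \in Q]inE.
  by case: (q \notin _) => /=; move: #|_ :|: _|; lia.
have yQ : y \notin Q by have := subsetP CR y yC; rewrite in_setC.
have qy' : q != y by apply: contraNneq yQ => <-.
have yCQ : y \in C :|: Q :\ q by rewrite inE yC.
have nbr_y : nbrs E y \subset C :|: Q :\ q.
  apply/subsetP => u yu; have := subsetP (nbrC y yC) u yu.
  rewrite !inE => /orP[->//|->]; rewrite andbT; apply/orP; right.
  by apply: contraTneq yu => ->; rewrite in_nbrs sE.
have := degree_nonadjacent_poor qQ qy' qy; have := degree_lt_card iE yCQ nbr_y.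
have := (leq_card_setU C (Q :\ q)).1; have := cardsC Q.
have := cardsD1 q Q; rewrite qQ; move: Qn k2; clear.
by move: #|_ :|: _| #|_ :\ _| #|C| #|~: Q| #|Q|; lia.
Qed.

(* Otherwise three components would be pairwise disjoint. *)
Lemma component_setC_poor_two x y z :
  Q != set0 -> x \notin Q -> y \notin Q -> z \notin Q ->
  y \notin component E (~: Q) x -> z \notin component E (~: Q) x ->
  z \in component E (~: Q) y.
Proof.
move=> Q0 xQ yQ zQ yx zx; apply: contrapT => /negP zy.
have := card_component_setC_poor Q0 xQ; have := card_component_setC_poor Q0 yQ.
have := card_component_setC_poor Q0 zQ.
have dxy := component_disjoint sE yx; have dxz := component_disjoint sE zx.
have dyz := component_disjoint sE zy.
have : component E (~: Q) x :|: (component E (~: Q) y :|: component E (~: Q) z)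
    \subset ~: Q by rewrite !subUset !component_sub // in_setC.
move=> /subset_leq_card; rewrite !cardsU (disjoint_setI0 dyz) setIUr.
rewrite (disjoint_setI0 dxy) (disjoint_setI0 dxz) setU0 cards0 !subn0.
by move: #|component _ _ x| #|component _ _ y| #|component _ _ z| #|~: Q|; clear; lia.
Qed.

Definition best_portal C q : Prop :=
  [/\ q \in Q :\: B, 0 < #|nbrs E q :&: C|
    & forall z, z \in Q :\: B -> #|nbrs E z :&: C| <= #|nbrs E q :&: C|].

Lemma exists_best_portal v : Q :\: B != set0 -> v \notin Q ->
  exists q, best_portal (component E (~: Q) v) q.
Proof.
case/set0Pn => q0 /setDP[q0Q q0B] vQ; set C := component E _ v.
have vR : v \in ~: Q by rewrite in_setC.
have CQ w : w \in C -> w \notin Q.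
  by move=> /(subsetP (component_sub E vR)); rewrite in_setC.
have connB := connected_on_setC_small sE noblock (subxx B).
have vB : v \in ~: B by rewrite in_setC (contraNN (subsetP small_sub_poor v)).
have q0C : q0 \notin C by apply: contraTN q0Q => /CQ.
have [|u [w [/setIP[_ uC] /setDP[wB wC] uw]]] :=
  @connected_on_exit _ _ sE (~: B) C v q0 connB vB _ (component_self _ _ _) q0C.
  by rewrite in_setC.
have wQ : w \in Q.
  apply: contrapT => /negP wQ; case/negP: wC.
  by apply: component_step vR uC _ uw; rewrite in_setC.
have wD : w \in Q :\: B by rewrite in_setD wQ -in_setC wB.
have [q qD q_max] := @arg_maxnP _ w (mem (Q :\: B)) (fun z => #|nbrs E z :&: C|) wD.
exists q; split=> //; apply: leq_trans (q_max w wD); apply/card_gt0P; exists u.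
by rewrite in_setI in_nbrs sE uw.
Qed.

Lemma exists_no_nbr_in_poor C q : #|~: Q| < 3 * #|C| -> #|Q| < 2 * k ->
  best_portal C q -> #|nbrs E q :&: C| <= k ->
  exists2 p, p \in C & forall z, z \in Q -> ~~ E p z.
Proof.
move=> bigC Q2k [_ _ q_max] le_k; apply: contrapT => no.
have le_sum : #|C| * 1 <= \sum_(z in Q) #|nbrs E z :&: C|.
  apply: leq_sum_card_nbrs => // w wC; apply/card_gt0P; apply: contrapT => none.
  apply: no; exists w => // z zQ; apply/negP => wz; apply: none.
  by exists z; rewrite in_setI in_nbrs wz.
have sum_le : \sum_(z in Q) #|nbrs E z :&: C| <= \sum_(z in Q) k.
  apply: leq_sum => z zQ; have [zB|zB] := boolP (z \in B).
    apply: leq_trans (subset_leq_card (subsetIl _ _)) _.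
    by rewrite inE in zB.
  by apply: leq_trans le_k; apply: q_max; rewrite in_setD zB.
have := leq_trans le_sum sum_le; rewrite sum_nat_const muln1.
have := leq_mul (ltnW Q2k) (leqnn k); move: card_setC_poor_ge order_ge bigC k2.
by move: #|Q| #|~: Q| #|C|; clear; nia.
Qed.

Definition sides C C' : Prop :=
  [/\ C :|: C' = ~: Q, [disjoint C & C'] & forall u v, u \in C -> v \in C' -> ~~ E u v].

Lemma sides_sym C C' : sides C C' -> sides C' C.
Proof.
move=> [CC dC nC]; split; first by rewrite setUC.
  by rewrite disjoint_sym.
by move=> u v uC' vC; rewrite sE nC.
Qed.

Lemma nbrs_setD_sides C C' q : sides C C' -> (forall v, v \in C' -> ~~ E q v) ->
  nbrs E q :\: Q = nbrs E q :&: C.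
Proof.
move=> [CC dC _] nC'; apply/setP => v; rewrite in_setD in_setI -in_setC -CC in_setU.
rewrite in_nbrs andbC; case qv: (E q v) => //=.
by have [/nC'|] := boolP (v \in C'); rewrite ?qv ?orbF.
Qed.

Lemma degree_poor_lt C C' q : sides C C' -> q \in Q ->
  (forall v, v \in C' -> ~~ E q v) -> degree E q < #|Q| + #|nbrs E q :&: C|.
Proof.
move=> sC qQ nC'; have qA : q \in Q :|: (nbrs E q :&: C) by rewrite inE qQ.
apply: leq_trans (degree_lt_card iE qA _) (leq_card_setU _ _).1.
rewrite -(nbrs_setD_sides sC nC'); apply/subsetP => v qv.
by rewrite in_setU in_setD qv andbT orbN.
Qed.

(* The degree sum of [q] and a vertex of [C'] that has no neighbour in [Q]. *)
Lemma sides_degree_sum C C' q q' : sides C C' -> q \in Q -> #|~: Q| < 3 * #|C'| ->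
  (forall v, v \in C' -> ~~ E q v) ->
  #|Q| < 2 * k -> best_portal C' q' -> #|nbrs E q' :&: C'| <= k ->
  n + 2 * k + 2 <= 2 * (#|C'| + #|Q| + #|nbrs E q :&: C|).
Proof.
move=> sC qQ bigC' nC' Q2k portal le_k.
have [p pC pQ] := exists_no_nbr_in_poor bigC' Q2k portal le_k.
have [CC _ nC] := sC.
have pR : p \notin Q by rewrite -in_setC -CC in_setU pC orbT.
have nbr_p : nbrs E p \subset C'.
  apply/subsetP => v; rewrite in_nbrs => pv.
  have : v \in ~: Q by rewrite in_setC; apply: contraTN pv => /pQ.
  by rewrite -CC => /setUP[vC|//]; have := nC v p vC pC; rewrite sE pv.
have dp := degree_lt_card iE pC nbr_p.
have dq := degree_poor_lt sC qQ nC'.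
have qp : q != p by apply: contraNneq pR => <-.
by have := ore qp (nC' p pC); lia.
Qed.

Lemma two_portals_count C1 C2 q1 q2 : sides C1 C2 ->
  #|~: Q| < 3 * #|C1| -> #|~: Q| < 3 * #|C2| ->
  best_portal C1 q1 -> best_portal C2 q2 -> q1 != q2 ->
  (forall v, v \in C2 -> ~~ E q1 v) -> (forall v, v \in C1 -> ~~ E q2 v) ->
  (k - #|nbrs E q1 :\: Q|) + (k - #|nbrs E q2 :\: Q|) + 2 <= #|Q|.
Proof.
move=> sC big1 big2 best1 best2 q12 q1C2 q2C1; have sC' := sides_sym sC.
rewrite (nbrs_setD_sides sC q1C2) (nbrs_setD_sides sC' q2C1).
have [/setDP[q1Q q1B] N1_gt0 _] := best1; have [/setDP[q2Q q2B] N2_gt0 _] := best2.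
have d1 := degree_poor_lt sC q1Q q1C2; have d2 := degree_poor_lt sC' q2Q q2C1.
rewrite inE -ltnNge in q1B; rewrite inE -ltnNge in q2B.
have Q2 : 1 < #|Q| by apply/card_gt1P; exists q1, q2.
have [CC /disjoint_setI0 dC _] := sC.
have cR := cardsC Q; rewrite -CC cardsU dC cards0 subn0 in cR.
have [Q2k|Q2k] := leqP (2 * k) #|Q|; first by lia.
have [N1k|N1k] := leqP k #|nbrs E q1 :&: C1|; first by lia.
have [N2k|N2k] := leqP k #|nbrs E q2 :&: C2|; first by lia.
have := sides_degree_sum sC q1Q big2 q1C2 Q2k best2 (ltnW N2k).
have := sides_degree_sum sC' q2Q big1 q2C1 Q2k best1 (ltnW N1k).
move: N1k N2k cR; move: #|nbrs E q1 :&: C1| #|nbrs E q2 :&: C2| #|C1| #|C2| #|Q|.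
by clear; lia.
Qed.

Lemma connected_on_portal C q : connected_on E C -> 0 < #|nbrs E q :&: C| ->
  connected_on E (q |: C).
Proof.
move=> connC /card_gt0P[u /setIP[qu uC]]; rewrite in_nbrs in qu.
exact: (connected_onU sE (@connected_on1 _ E q) connC (set11 q) uC qu).
Qed.

Lemma two_sides_2k_ST C1 C2 q1 q2 : sides C1 C2 ->
  connected_on E C1 -> connected_on E C2 ->
  #|~: Q| < 3 * #|C1| -> #|~: Q| < 3 * #|C2| ->
  best_portal C1 q1 -> best_portal C2 q2 -> has_2k_ST k E.
Proof.
move=> sC conn1 conn2 big1 big2 best1 best2; have [CC _ nC] := sC.
have [q1D N1_gt0 _] := best1; have [q2D N2_gt0 _] := best2.
have [[p [pD p1 p2]]|none] := pselect (exists p, [/\ p \in Q :\: B,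
    0 < #|nbrs E p :&: C1| & 0 < #|nbrs E p :&: C2|]).
  have [pQ pB] := setDP pD; apply: (one_poor_root_2k_ST pQ pB).
  have /card_gt0P[u /setIP[pu uC2]] := p2; rewrite in_nbrs in pu.
  rewrite -CC setUA.
  exact: (connected_onU sE (connected_on_portal conn1 p1) conn2 (setU11 _ _) uC2 pu).
have no_nbr q C : ~ (0 < #|nbrs E q :&: C|) -> forall v, v \in C -> ~~ E q v.
  move=> N0 v vC; apply/negP => qv; apply: N0; apply/card_gt0P; exists v.
  by rewrite in_setI in_nbrs qv.
have q1C2 : forall v, v \in C2 -> ~~ E q1 v.
  by apply: no_nbr => N_gt0; apply: none; exists q1.
have q2C1 : forall v, v \in C1 -> ~~ E q2 v.
  by apply: no_nbr => N_gt0; apply: none; exists q2.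
have q12 : q1 != q2.
  by apply/eqP => q12; apply: none; exists q1; split; rewrite // q12.
have [q1Q _] := setDP q1D; have [q2Q _] := setDP q2D.
apply: (two_poor_roots_2k_ST q1D q2D q12).
- move=> v; rewrite -in_setC -CC => /setUP[/q2C1|/q1C2] /negPf->; rewrite ?andbF //.
- rewrite -CC setUACA.
  apply: (connected_onU sE (connected_on_portal conn1 N1_gt0)
    (connected_on_portal conn2 N2_gt0) (setU11 _ _) (setU11 _ _)).
  exact: poor_clique.
- exact: two_portals_count sC big1 big2 best1 best2 q12 q1C2 q2C1.
Qed.

Lemma no_blocking_set_2k_ST : has_2k_ST k E.
Proof.
have [QB|/subsetPn[q0 q0Q q0B]] := boolP (Q \subset B).
  exact: poor_sub_small_2k_ST.
have D0 : Q :\: B != set0 by apply/set0Pn; exists q0; rewrite in_setD q0B.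
have Q0 : Q != set0 by apply/set0Pn; exists q0.
have [x xR] : exists x, x \in ~: Q.
  by apply/card_gt0P; have := card_setC_poor_ge; have := order_ge; nia.
have xQ : x \notin Q by rewrite -in_setC.
have [q1 best1] := exists_best_portal D0 xQ.
have conn1 := connected_on_component sE xR.
have [whole|/subsetPn[y yR yx]] := boolP (~: Q \subset component E (~: Q) x).
  have [/setDP[qQ qB] N_gt0 _] := best1; apply: (one_poor_root_2k_ST qQ qB).
  have -> : ~: Q = component E (~: Q) x.
    by apply/eqP; rewrite eqEsubset whole component_sub.
  exact: connected_on_portal.
have yQ : y \notin Q by rewrite -in_setC.
have [q2 best2] := exists_best_portal D0 yQ.
have dis := component_disjoint sE yx.
apply: (two_sides_2k_ST _ conn1 (connected_on_component sE yR) _ _ best1 best2).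
- split=> //.
    apply/eqP; rewrite eqEsubset subUset !component_sub //=; apply/subsetP => z.
    rewrite in_setU in_setC => zQ.
    have [//|zx] := boolP (z \in component E (~: Q) x).
    exact: component_setC_poor_two zx.
  move=> u v uC vC; apply/negP => uv; have vR := subsetP (component_sub E yR) v vC.
  by have := disjointFr dis (component_step xR uC vR uv); rewrite vC.
- exact: card_component_setC_poor.
- exact: card_component_setC_poor.
Qed.

End Construction.

Lemma sigma2_degree_sum (R : realType) (V : finType) (E : rel V) (k : nat) (u v : V) :
  (((#|V|%:R + 2 * k%:R - 2) / 2 : R)%:E <= sigma2 R E)%E ->
  u != v -> ~~ E u v -> #|V| + 2 * k <= 2 * (degree E u + degree E v) + 2.
Proof.
move=> sigma2_ge uv nuv.
have := @bigmin_le_cond _ _ _ (+oo%E : \bar R) (u, v)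
  (fun p => (p.1 != p.2) && ~~ E p.1 p.2)
  (fun p => ((degree E p.1 + degree E p.2)%:R)%:E).
rewrite /= uv nuv => /(_ isT) /(le_trans sigma2_ge); rewrite lee_fin natrD => sum_ge.
by rewrite -(ler_nat R) !(natrD, natrM); lra.
Qed.

Local Open Scope ring_scope.

Theorem theorem1p2 (R : realType) (k : nat) (k_ge2 : (2 <= k)%N)
    (n1 : nat) (n1P : is_n1 R k n1)
    (V : finType) (E : rel V)
    (E_simple : simple_graph E) (E_conn : graph_connected E)
    (V_ge : (n1 <= #|V|)%N)
    (sigma2_ge : (((#|V|%:R + 2 * k%:R - 2) / 2 : R)%:E <= sigma2 R E)%E) :
  has_2k_ST k E <-> ~ (exists U : {set V}, blocking_set k E U).
Proof.
have [sE iE] := E_simple; split; first exact: has_2k_ST_no_blocking_set.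
apply: no_blocking_set_2k_ST => //.
- exact: large_order_n1 n1P V_ge.
- by move=> u v; exact: sigma2_degree_sum sigma2_ge.
Qed.
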